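(* Let $G$ be a totally disconnected locally compact group, let $\mathfrak{A}\subseteq \mathrm{Aut}(G)$ be a set of automorphisms of $G$, and let $\beta\in\mathrm{Aut}(G)$ be an automorphism which commutes with each $\alpha\in\mathfrak{A}$. Suppose that there is a compact open subgroup $U$ of $G$ which is tidy for each $\alpha\in\mathfrak{A}$. Then there is a compact open subgroup $W$ of $G$ which is tidy for each automorphism in $\mathfrak{A}\cup\{\beta\}$.
   Context: $\mathrm{Aut}(G)$ is the group of automorphisms of the topological group $G$ (continuous with continuous inverse). For $\alpha\in\mathrm{Aut}(G)$ the scale of $\alpha$ is the positive integer $s(\alpha)=\min\{[\alpha(V):\alpha(V)\cap V] : V \text{ a compact open subgroup of } G\}$, and a compact open subgroup $V$ is tidy for $\alpha$ if this minimum is attained at $V$. It is known that a compact open subgroup $V$ is tidy for $\alpha$ if and only if (T1) $V=V_+V_-$, where $V_\pm=\bigcap_{n\ge 0}\alpha^{\pm n}(V)$, and (T2) $V_{++}=\bigcup_{n\ge 0}\alpha^n(V_+)$ is closed. *)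

(* Defs.v *)
From HB Require Import structures.
From mathcomp Require Import all_boot all_order finmap.
From mathcomp Require Import monoid.
From mathcomp Require Import boolp classical_sets functions cardinality.
From mathcomp Require Import topology.

Set Implicit Arguments.
Unset Strict Implicit.
Unset Printing Implicit Defensive.

Local Open Scope classical_set_scope.
Local Open Scope group_scope.

HB.mixin Record isTopologicalGroup G of Topological G & Group G := {
  mulg_continuous : continuous (fun x : G * G => x.1 * x.2);
  invg_continuous : continuous (fun x : G => x^-1)
}.

#[short(type="topologicalGroupType")]
HB.structure Definition TopologicalGroup :=
  {G of Topological G & Group G & isTopologicalGroup G}.

(* The library's [locally_compact] asks for closed compact neighbourhoods and
   nothing below assumes the Hausdorff property: a totally disconnected space
   has closed points, so a totally disconnected topological group is Hausdorff
   and every convention for local compactness agrees. *)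
Definition tdlc (G : topologicalGroupType) : Prop :=
  totally_disconnected [set: G] /\ locally_compact [set: G].

Definition topAut (G : topologicalGroupType) : set (G -> G) :=
  [set alpha | {morph alpha : x y / x * y} /\
    exists alphaV : G -> G, [/\ cancel alpha alphaV, cancel alphaV alpha,
      continuous alpha & continuous alphaV]].

Definition compact_open_subgroup (G : topologicalGroupType) (V : set G) : Prop :=
  [/\ group_closed (mem V), compact V & open V].

Definition left_cosets (G : groupType) (H K : set G) : set (set G) :=
  [set [set x * k | k in K] | x in H].

(* [fset_set] sends an infinite set to the empty one, so this is the index
   [H : K] only when that index is finite; it is used below only for H compact
   and K open, where it is. *)
Definition subgroup_index (G : groupType) (H K : set G) : nat :=
  #|` fset_set (left_cosets H K) |.

Definition displacement (G : topologicalGroupType) (alpha : G -> G)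
    (V : set G) : nat :=
  subgroup_index (alpha @` V) (alpha @` V `&` V).

(* The default value 0 is never taken when G is totally disconnected and locally
   compact, since such a group has a compact open subgroup (van Dantzig). *)
Definition scale (G : topologicalGroupType) (alpha : G -> G) : nat :=
  let D := [set displacement alpha V | V in @compact_open_subgroup G] in
  xget 0%N (D `&` lbound D).

Definition tidy (G : topologicalGroupType) (alpha : G -> G) (V : set G) : Prop :=
  compact_open_subgroup V /\ displacement alpha V = scale alpha.

(* Main.v *)
Require Import Defs.
From mathcomp Require Import all_boot all_order finmap monoid.
From mathcomp Require Import boolp classical_sets functions cardinality.
From mathcomp Require Import topology.
From mathcomp Require Import zify.

(** Tidiness is defined by minimality of an index; the proof replaces it by the
    structural condition [factor_convex a b V], where [b] is the inverse of
    [a]: every point of [V] is a product of a point whose backward orbit stays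
    in [V] and a point whose forward orbit does, and an orbit segment with both
    ends in [V] lies in [V].

    The two conditions agree.  Let D_n(V) be the index of the intersection of
    a^n(V) and V in a^n(V).  The index of compact open subgroups satisfies a
    multiplicative triangle inequality, so D_(mn)(V) <= D_m(V)^n, and D_n(V)
    and D_n(U) differ at most by a factor that does not depend on n.
    Factorization and convexity give D_n(V) = D_1(V)^n for all n, which makes
    D_1(V) the exponential growth rate common to all compact open subgroups,
    hence minimal ([factor_convex_min]).  Conversely, once one such subgroup exists, any V
    with minimal D_1(V) has D_n(V) = D_1(V)^n, and equality in the counting
    estimates returns both structural conditions ([min_factor_convex]).

    The core is [common_factor_convex]: a compact open U that is [factor_convex]
    for every automorphism in A is modified so as to become [factor_convex] for
    b as well.  (With A empty this is the existence result used above.)  Two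
    things can go wrong for b.
    - Factorization.  It holds for the intersection of U, b(U), ..., b^n(U) when
      n is large, because a decreasing sequence of indices becomes stationary
      ([exists_factor]).  Each b^k(U) is as good as U for the automorphisms in A,
      which commute with b, and [factor_convex] subgroups are stable under
      intersection ([factor_convexI]).
    - Convexity.  Once factorization holds, convexity amounts to U containing
      every homoclinic point, that is every point whose b-orbit is in U at all
      large positive and negative times.  This holds as soon as U contains the
      nub of b, the intersection over all compact open V of the closures of the
      groups of homoclinic points ([homoclinic_sub]).  The nub is compact and,
      being canonical, invariant under every automorphism commuting with b.
    It remains to absorb the nub K without losing anything for A: the subgroup U
    is replaced by the stabilizer in G of the finite subset KU/U of G/U
    ([coset_stabilizer_factor_convex]), before the intersection is taken.

    What makes intersections and stabilizers work is that a point of a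
    [factor_convex] subgroup with relatively compact forward orbit never leaves
    the subgroup ([bounded_fwd]). *)

Set Implicit Arguments.
Unset Strict Implicit.
Unset Printing Implicit Defensive.

Local Open Scope classical_set_scope.
Local Open Scope group_scope.

(** * Compactness and open subgroups *)

Record subgrp (G : groupType) (V : set G) : Prop := Subgrp {
  subgrp1 : V 1;
  subgrpM : forall x y, V x -> V y -> V (x * y);
  subgrpV : forall x, V x -> V x^-1 }.

Record cosubgrp (G : topologicalGroupType) (V : set G) : Prop := Cosubgrp {
  cosubgrp_subgrp :> subgrp V;
  cosubgrp_compact : compact V;
  cosubgrp_open : open V }.

Lemma cosubgrpP (G : topologicalGroupType) (V : set G) :
  compact_open_subgroup V <-> cosubgrp V.
Proof.
split=> [[V1 cV oV]|[[V1 VM VV] cV oV]].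
  split=> //; split; first by have [+ _] := V1; rewrite inE.
    by move=> x y Vx Vy; apply: set_mem; apply: group_closedM V1 _ _ _ _;
      apply: mem_set.
  by move=> x Vx; apply: set_mem; apply: group_closedV V1 _ _; apply: mem_set.
split=> //; split; first exact: mem_set.
by move=> x y /set_mem Vx /set_mem Vy; apply: mem_set; apply: VM => //;
  apply: VV.
Qed.

Section Topology.
Variable G : topologicalGroupType.
Implicit Types (V C : set G) (x y : G).

Lemma subgrpI V W : subgrp V -> subgrp W -> subgrp (V `&` W).
Proof.
case=> V1 VM VV [W1 WM WV]; split=> //.
  by move=> x y [Vx Wx] [Vy Wy]; split; [apply: VM | apply: WM].
by move=> x [Vx Wx]; split; [apply: VV | apply: WV].
Qed.

Lemma mulgl_continuous x : continuous (fun y : G => x * y).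
Proof.
move=> y; apply: (@cvg_comp _ _ _ (fun z : G => (x, z)) (fun p => p.1 * p.2)
  _ _ _ _ (mulg_continuous (x, y))).
by apply: cvg_pair; [exact: cvg_cst | exact: cvg_id].
Qed.

Lemma mulgr_continuous x : continuous (fun y : G => y * x).
Proof.
move=> y; apply: (@cvg_comp _ _ _ (fun z : G => (z, x)) (fun p => p.1 * p.2)
  _ _ _ _ (mulg_continuous (y, x))).
by apply: cvg_pair; [exact: cvg_id | exact: cvg_cst].
Qed.

Lemma nbhs_lcoset V x : subgrp V -> open V -> nbhs x [set y | V (x^-1 * y)].
Proof.
move=> sV oV; apply: (@mulgl_continuous x^-1 x); apply: open_nbhs_nbhs;
  split=> //.
by rewrite mulVg; apply: subgrp1.
Qed.

Lemma nbhs_rcoset V x : subgrp V -> open V -> nbhs x [set y | V (y * x^-1)].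
Proof.
move=> sV oV; apply: (@mulgr_continuous x^-1 x); apply: open_nbhs_nbhs;
  split=> //.
by rewrite mulgV; apply: subgrp1.
Qed.

Lemma closed_right_invariant V C : subgrp V -> open V ->
  (forall c v, C c -> V v -> C (c * v)) -> closed C.
Proof.
move=> sV oV CV p /(_ _ (nbhs_lcoset p sV oV)) [c [Cc Vc]].
have -> : p = c * (p^-1 * c)^-1 by rewrite !gnorm.
by apply: CV => //; apply: subgrpV.
Qed.

Lemma open_subgrp_closed V : subgrp V -> open V -> closed V.
Proof.
by move=> sV oV; apply: (closed_right_invariant sV oV); apply: subgrpM.
Qed.

Lemma cosubgrp_closed V : cosubgrp V -> closed V.
Proof. by case=> sV _ oV; apply: open_subgrp_closed. Qed.

Lemma cosubgrpI V W : cosubgrp V -> cosubgrp W -> cosubgrp (V `&` W).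
Proof.
move=> cV cW; split; first exact: subgrpI cV cW.
  by apply: compact_closedI; [exact: cosubgrp_compact | exact: cosubgrp_closed].
by apply: openI; apply: cosubgrp_open.
Qed.

Lemma compact_mulg C D : compact C -> compact D ->
  compact [set x.1 * x.2 | x in C `*` D].
Proof.
move=> cC cD; apply: continuous_compact; last exact: compact_setX.
by apply: continuous_subspaceT; apply: mulg_continuous.
Qed.

Lemma compact_invg C : compact C -> compact [set x^-1 | x in C].
Proof.
move=> cC; apply: continuous_compact => //.
by apply: continuous_subspaceT; apply: invg_continuous.
Qed.

Lemma compact_cluster_seq C (y : nat -> G) : compact C -> (forall n, C (y n)) ->
  exists2 c, C c & forall B, nbhs c B ->
    forall N, exists2 m, (N <= m)%N & B (y m).
Proof.
move=> cC Cy.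
have [|c [Cc cl]] := cC (y @ \oo) _; first by exists 0%N => // n _; apply: Cy.
exists c => // B nB N.
have [|x [[m Nm <-] Bx]] := cl (y @` [set m | (N <= m)%N]) B _ nB.
  by exists N => // m /= Nm; exists m.
by exists m.
Qed.

(** Some term is close to infinitely many later terms: cluster points exist, and
    [V] is a group, so two terms near the same cluster point differ by an
    element of [V]. *)
Lemma compact_recurrent C V (y : nat -> G) : compact C -> (forall n, C (y n)) ->
  subgrp V -> open V ->
  exists n, forall N, exists2 m, (N <= m)%N & V ((y n)^-1 * y m).
Proof.
move=> cC Cy sV oV; have [c _ clc] := compact_cluster_seq cC Cy.
have {}clc := clc _ (nbhs_lcoset c sV oV).
have [n _ Vn] := clc 0%N; exists n => N; have [m Nm Vm] := clc N;
  exists m => //.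
have -> : (y n)^-1 * y m = (c^-1 * y n)^-1 * (c^-1 * y m) by rewrite !gnorm.
by apply: subgrpM => //; apply: subgrpV.
Qed.

Lemma compact_directed_cap (I : Type) (D : set I) (F : I -> set G) C i0 :
  compact C -> D i0 -> F i0 `<=` C ->
  (forall i, D i -> closed (F i)) -> (forall i, D i -> F i !=set0) ->
  (forall i j, D i -> D j -> exists2 k, D k & F k `<=` F i `&` F j) ->
  exists2 c, C c & forall i, D i -> F i c.
Proof.
move=> cC D0 F0 clF nF dF.
have pF : ProperFilter (filter_from D F).
  apply: filter_from_proper => //; apply: filter_from_filter; first
    by exists i0.
  by move=> i j Di Dj; have [k Dk kij] := dF i j Di Dj; exists k.
have [|c [Cc cl]] := cC _ pF; first by exists i0.
exists c => // i Di; apply: clF => // B nB; apply: cl => //; by exists i.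
Qed.

Lemma compact_nested_cap (F : nat -> set G) C :
  compact C -> F 0%N `<=` C -> (forall n, closed (F n)) ->
    (forall n, F n !=set0) ->
  (forall m n, (m <= n)%N -> F n `<=` F m) -> exists c, forall n, F n c.
Proof.
move=> cC F0 clF nF dF.
have dir i j : exists2 k, [set: nat] k & F k `<=` F i `&` F j.
  by exists (maxn i j) => //; rewrite subsetI; split; apply: dF;
    rewrite ?leq_maxl ?leq_maxr.
have [c _ cF] := compact_directed_cap cC I F0 (fun n _ => clF n) (fun n _ =>
  nF n)
  (fun i j _ _ => dir i j).
by exists c => n; apply: cF.
Qed.

Lemma subgrp_nbhs1_open V : subgrp V -> nbhs 1 V -> open V.
Proof.
move=> sV nV; rewrite openE => x Vx.
have : nbhs x [set y | V (x^-1 * y)].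
  by apply: (@mulgl_continuous x^-1 x); rewrite mulVg.
apply: filterS => y /= Vy; have -> : y = x * (x^-1 * y) by rewrite !gnorm.
exact: subgrpM.
Qed.

(** The powers of [x] recur, so some power of [x] with positive exponent lies in
    the group [O], and the inverse of that power is in [C]; multiplying by a
    power of [x] gives the inverse of [x]. *)
Lemma compact_semigroup_subgrp O C : compact C -> C 1 ->
  (forall x y, C x -> C y -> C (x * y)) -> subgrp O -> open O -> O `<=` C ->
  cosubgrp C.
Proof.
move=> cC C1 CM sO oO OC.
have CV x : C x -> C x^-1.
  move=> Cx.
  have CX n : C (x ^+ n) by elim: n => [|n IH]; rewrite ?expg0 // expgS;
    apply: CM.
  have [n rec] := compact_recurrent cC CX sO oO.
  have [m nm] := rec n.+1.
  rewrite -(subnKC nm) addSnnS expgnDr mulKg expgS => /(subgrpV sO)/OC Cm.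
  have -> : x^-1 = x ^+ (m - n.+1) * (x * x ^+ (m - n.+1))^-1 by rewrite !gnorm.
  exact: CM.
split=> //; apply: subgrp_nbhs1_open => //.
by apply: (@filterS _ _ _ O) => //; apply: open_nbhs_nbhs; split=> //;
  apply: subgrp1.
Qed.

End Topology.

(** * Forward orbits and the structural form of tidiness *)

(** The inverse is a parameter rather than existentially quantified, so that
    [aut_pair_sym] turns each statement about forward orbits into one about
    backward orbits. *)
Record aut_pair (G : topologicalGroupType) (a b : G -> G) : Prop := AutPair {
  autM : {morph a : x y / x * y};
  autK : cancel a b;
  autVK : cancel b a;
  aut_continuous : continuous a;
  autV_continuous : continuous b }.

(** Willis's subgroup V_-, and V_+ when [a] is replaced by its inverse. *)
Definition fwd (T : Type) (a : T -> T) (V : set T) : set T :=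
  [set x | forall n, V (iter n a x)].

(** Willis's subgroup V_--, and V_++ when [a] is replaced by its inverse. *)
Definition eventually_in (T : Type) (a : T -> T) (V : set T) : set T :=
  [set x | exists n, fwd a V (iter n a x)].

(** Asking for a compact set only from some time on makes invariance under [a]
    and its inverse immediate; the orbit is then relatively compact anyway. *)
Definition bounded (T : topologicalType) (a : T -> T) : set T :=
  [set x | exists2 C, compact C & exists N, forall n, C (iter (N + n) a x)].

(** Conditions (T1) and (T2), with (T2) in the form that refers to finite orbit
    segments only; [b] stands for the inverse of [a]. *)
Record factor_convex (G : topologicalGroupType) (a b : G -> G)
    (V : set G) : Prop := FactorConvex {
  fc_cosubgrp :> cosubgrp V;
  fc_factor : forall x, V x ->
    exists y z, [/\ fwd b V y, fwd a V z & x = y * z];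
  fc_convex : forall n x, V x -> V (iter n a x) ->
    forall k, (k <= n)%N -> V (iter k a x) }.

Section Dynamics.
Variable G : topologicalGroupType.
Implicit Types (V C : set G) (x y : G) (a b : G -> G).

Lemma aut_pair_sym a b : aut_pair a b -> aut_pair b a.
Proof.
case=> aM aK bK ca cb; split=> // x y.
by apply: (can_inj aK); rewrite aM !bK.
Qed.

Lemma aut1 a b : aut_pair a b -> a 1 = 1.
Proof.
by move=> ab; apply: (@mulgI _ (a 1)); rewrite -(autM ab) !mulg1.
Qed.

Lemma autV a b x : aut_pair a b -> a x^-1 = (a x)^-1.
Proof.
move=> ab; apply: (@mulgI _ (a x)).
by rewrite -(autM ab) !mulgV (aut1 ab).
Qed.

Lemma aut_pair_iter a b n : aut_pair a b -> aut_pair (iter n a) (iter n b).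
Proof.
move=> ab; elim: n => [|n [IM IK IVK Ic IcV]].
  by split=> // x; exact: cvg_id.
split.
- by move=> x y; rewrite !iterS IM (autM ab).
- by move=> x; rewrite [iter n.+1 b _]iterSr iterS (autK ab) IK.
- by move=> x; rewrite [iter n.+1 a _]iterSr iterS (autVK ab) IVK.
- by move=> x; apply: (@continuous_comp _ _ _ (iter n a) a); [exact: Ic|
  exact: (aut_continuous ab)].
- by move=> x; apply: (@continuous_comp _ _ _ (iter n b) b); [exact: IcV|
  exact: (autV_continuous ab)].
Qed.

Lemma iter_autM a b n : aut_pair a b -> {morph iter n a : x y / x * y}.
Proof. by move=> /(aut_pair_iter n)/autM. Qed.

Lemma iter_autV a b n x : aut_pair a b -> iter n a x^-1 = (iter n a x)^-1.
Proof. by move=> /(aut_pair_iter n)/autV. Qed.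

Lemma iter_aut1 a b n : aut_pair a b -> iter n a 1 = 1.
Proof. by move=> /(aut_pair_iter n)/aut1. Qed.

Lemma iter_autK a b n : aut_pair a b -> cancel (iter n a) (iter n b).
Proof. by move=> /(aut_pair_iter n)/autK. Qed.

Lemma iter_cancell a b m n x : aut_pair a b -> (m <= n)%N ->
  iter n a (iter m b x) = iter (n - m) a x.
Proof.
move=> ab mn; rewrite -{1}(subnK mn) iterD.
by rewrite (iter_autK m (aut_pair_sym ab)).
Qed.

Lemma iter_cancelr a b m n x : aut_pair a b -> (m <= n)%N ->
  iter m a (iter n b x) = iter (n - m) b x.
Proof.
move=> ab mn; rewrite -{1}(subnKC mn) iterD.
by rewrite (iter_autK m (aut_pair_sym ab)).
Qed.

Lemma fwd_subgrp a b V : aut_pair a b -> subgrp V -> subgrp (fwd a V).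
Proof.
move=> ab sV; split=> [n|x y Vx Vy n|x Vx n].
- by rewrite (iter_aut1 n ab); apply: subgrp1.
- by rewrite (iter_autM n ab); apply: subgrpM.
- by rewrite (iter_autV n x ab); apply: subgrpV.
Qed.

Lemma fwd_sub a V : fwd a V `<=` V.
Proof. by move=> x /(_ 0%N). Qed.

Lemma fwd_iter a V n x : fwd a V x -> fwd a V (iter n a x).
Proof. by move=> Vx m; rewrite -iterD. Qed.

Lemma fwdS a V W : V `<=` W -> fwd a V `<=` fwd a W.
Proof. by move=> VW x Vx n; apply: VW. Qed.

Lemma eventually_in_subgrp a b V : aut_pair a b -> subgrp V ->
  subgrp (eventually_in a V).
Proof.
move=> ab sV; split=> [|x y [m Vx] [n Vy]|x [n Vx]].
- by exists 0%N; apply: subgrp1; apply: fwd_subgrp ab sV.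
- exists (m + n)%N; rewrite (iter_autM _ ab).
  apply: (subgrpM (fwd_subgrp ab sV)); last by rewrite iterD; apply: fwd_iter.
  by rewrite addnC iterD; apply: fwd_iter.
- exists n; rewrite (iter_autV _ _ ab).
  by apply: (subgrpV (fwd_subgrp ab sV)).
Qed.

Lemma fwd_eventually a V : fwd a V `<=` eventually_in a V.
Proof. by move=> x Vx; exists 0%N. Qed.

Lemma eventually_iter a b V n x : aut_pair a b ->
  eventually_in a V (iter n a x) <-> eventually_in a V x.
Proof.
move=> ab; split=> [[m Vx]|[m Vx]].
  by exists (m + n)%N; rewrite iterD.
by exists m; rewrite -iterD addnC iterD; apply: fwd_iter.
Qed.

Lemma eventually_iterV a b V n x : aut_pair a b ->
  eventually_in a V (iter n b x) <-> eventually_in a V x.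
Proof.
move=> ab; rewrite -(eventually_iter V n (iter n b x) ab).
by rewrite (iter_autK n (aut_pair_sym ab)).
Qed.

Lemma boundedM a b x y : aut_pair a b ->
  bounded a x -> bounded a y -> bounded a (x * y).
Proof.
move=> ab [C cC [m Cx]] [D cD [n Dy]].
exists [set p.1 * p.2 | p in C `*` D]; first exact: compact_mulg.
exists (m + n)%N => k; rewrite (iter_autM _ ab).
exists (iter (m + n + k) a x, iter (m + n + k) a y) => //; split=> /=.
  by rewrite -addnA.
by rewrite addnAC addnC.
Qed.

Lemma boundedV a b x : aut_pair a b -> bounded a x -> bounded a x^-1.
Proof.
move=> ab [C cC [m Cx]].
exists [set p^-1 | p in C]; first exact: compact_invg.
by exists m => k; rewrite (iter_autV _ _ ab); exists (iter (m + k) a x).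
Qed.

Lemma eventually_bounded a V x : compact V -> eventually_in a V x ->
  bounded a x.
Proof.
by move=> cV [m Vx]; exists V => //; exists m => n; rewrite addnC iterD.
Qed.

Lemma fwd_bounded a V x : compact V -> fwd a V x -> bounded a x.
Proof. by move=> cV /fwd_eventually; apply: eventually_bounded. Qed.

Lemma bounded_iter a n x : bounded a (iter n a x) <-> bounded a x.
Proof.
split=> [[C cC [m Cx]]|[C cC [m Cx]]]; exists C => //.
  by exists (m + n)%N => k; rewrite addnAC iterD.
by exists m => k; rewrite -iterD -addnA.
Qed.

Lemma bounded_iterV a b n x : aut_pair a b ->
  bounded a (iter n b x) <-> bounded a x.
Proof.
move=> ab; rewrite -(bounded_iter a n (iter n b x)).
by rewrite (iter_autK n (aut_pair_sym ab)).
Qed.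

Lemma factor_convex_sym a b V : aut_pair a b ->
  factor_convex a b V -> factor_convex b a V.
Proof.
move=> ab [cV fV xV]; split=> //.
  move=> x /(subgrpV cV) /fV [y [z [Vy Vz xyz]]].
  exists z^-1, y^-1; split.
  - exact: (subgrpV (fwd_subgrp ab cV)).
  - exact: (subgrpV (fwd_subgrp (aut_pair_sym ab) cV)).
  - by rewrite -invgM -xyz invgK.
move=> n x Vx Vnx k kn.
have := xV n _ Vnx; rewrite (iter_autK n (aut_pair_sym ab)) =>
  /(_ Vx (n - k)%N).
by rewrite leq_subr (iter_cancelr _ ab) ?leq_subr // subKn //; apply.
Qed.

(** By factorization only a point [p] with backward orbit in [V] matters.  If
    its forward orbit is bounded, two terms at times [n] and [m], with [m] much
    larger, differ by an element [q] of [V].  Pulled back by the time [m], both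
    terms are in [V], so convexity puts the whole backward segment of [q] in
    [V].  On the part of that segment where the term at time [n] has already
    been pulled back into [V], the other term must be in [V] too, and this is
    an arbitrary point of the forward orbit of [p]. *)
Lemma bounded_fwd a b V x : aut_pair a b -> factor_convex a b V ->
  V x -> bounded a x -> fwd a V x.
Proof.
move=> ab tV Vx bx.
have ba := aut_pair_sym ab; have [cV fV _] := tV.
have [p [q [Vp Vq xpq]]] := fV _ Vx.
have sf := fwd_subgrp ab cV.
suff: fwd a V p by move=> fp; rewrite xpq; apply: (subgrpM sf).
have : bounded a p.
  have -> : p = x * q^-1 by rewrite xpq mulgK.
  by apply: (boundedM ab) => //; apply: (boundedV ab);
    apply: fwd_bounded (cosubgrp_compact cV) _.
case=> C cC [N CN].
have [n rec] := compact_recurrent cC CN cV (cosubgrp_open cV).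
move=> j; have [m mnj Vq'] := rec (n + j)%N.
set q' := _ * _ in Vq'.
have e k : (N + n <= k)%N -> (k <= N + m)%N ->
    iter k b q' = (iter (k - (N + n)) b p)^-1 * iter (N + m - k) a p.
  move=> k1 k2; rewrite /q' (iter_autM _ ba) (iter_autV _ _ ba).
  by rewrite (iter_cancell _ ba) // (iter_cancelr _ ba).
have Vp' i : V (iter i b p)^-1 by apply: (subgrpV cV).
have [Nn Nm] : (N + n <= N + m)%N /\ (N + n <= N + m - j)%N by lia.
have := fc_convex (factor_convex_sym ab tV) (n := N + m) Vq'.
rewrite e // subnn /= => /(_ _ (N + m - j)%N).
rewrite leq_subr e ?leq_subr // subKn; last by lia.
move=> /(_ (subgrpM cV (Vp' _) (Vp 0%N)) isT) Vj.
rewrite -[iter j a p](mulKg (iter (N + m - j - (N + n)) b p)^-1).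
by rewrite invgK; apply: (subgrpM cV); first exact: Vp.
Qed.

(** In Willis's notation, an element of V_++ with bounded forward orbit lies in
    V_0, the largest invariant subgroup of V. *)
Lemma eventually_bounded_fwd a b V x : aut_pair a b -> factor_convex a b V ->
  eventually_in b V x -> bounded a x -> fwd a V x /\ fwd b V x.
Proof.
move=> ab tV [n Vx] bx; have ba := aut_pair_sym ab.
have Vx' : fwd a V (iter n b x).
  apply: (bounded_fwd ab tV); first exact: (fwd_sub Vx).
  by rewrite (bounded_iterV _ _ ab).
split=> m.
  by have := Vx' (m + n)%N; rewrite iterD (iter_autK n ba).
have [mn|/ltnW mn] := leqP n m; first by rewrite -(subnK mn) iterD.
by have := Vx' (n - m)%N; rewrite (iter_cancelr _ ab) ?leq_subr // subKn.
Qed.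

(** The backward orbit of a point of V_+ accumulates only at V_0. *)
Lemma fwd_approach a b V O x : aut_pair a b -> cosubgrp V -> subgrp O ->
  open O ->
  fwd b V x -> exists n z, [/\ fwd a V z, fwd b V z & O (iter n b x * z^-1)].
Proof.
move=> ab cV sO oO Vx; have ba := aut_pair_sym ab.
have [z _ clz] := compact_cluster_seq (cosubgrp_compact cV) Vx.
have [n _ On] := clz _ (nbhs_rcoset z sO oO) 0%N.
exists n, z; split=> // k.
- have Ik := aut_pair_iter k ab.
  apply: (@preimage_closed _ _ (iter k a) V) => //.
  + by move=> y _; apply: (aut_continuous Ik).
  + exact: cosubgrp_closed.
  move=> B /clz /(_ k) [m km Bm]; exists (iter m b x); split=> //=.
  by rewrite (iter_cancelr _ ab).
- have Ik := aut_pair_iter k ba.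
  apply: (@preimage_closed _ _ (iter k b) V) => //.
  + by move=> y _; apply: (aut_continuous Ik).
  + exact: cosubgrp_closed.
  move=> B /clz /(_ 0%N) [m _ Bm]; exists (iter m b x); split=> //=.
  by rewrite -iterD.
Qed.

(** Only factorization needs an argument.  Write [x] as p q in U and as r s
    in V.  The point [p] of U_+ can be corrected by an element of U_0 so that its
    backward orbit enters V ([fwd_approach]); the corrected point [y] is then in
    V_++, and comparing the two factorizations shows that r^-1 y has bounded
    forward orbit, hence is in V_0.  So [y] is in both U_+ and V_+, and
    y^-1 x is in both U_- and V_-. *)
Lemma factor_convexI a b U V : aut_pair a b ->
  factor_convex a b U -> factor_convex a b V -> factor_convex a b (U `&` V).
Proof.
move=> ab tU tV; have ba := aut_pair_sym ab.
have [cU fU xU] := tU; have [cV fV xV] := tV.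
split; first exact: cosubgrpI; last first.
  by move=> n x [Ux Vx] [Unx Vnx] k kn; split; [exact: (xU n)|exact: (xV n)].
have tU' := factor_convex_sym ab tU; have tV' := factor_convex_sym ab tV.
have sUb := fwd_subgrp ba cU; have sVb := fwd_subgrp ba cV.
have sUa := fwd_subgrp ab cU; have sVa := fwd_subgrp ab cV.
have KU := cosubgrp_compact cU; have KV := cosubgrp_compact cV.
move=> x [Ux Vx].
have [p [q [Up Uq xpq]]] := fU _ Ux; have [r [s [Vr Vs xrs]]] := fV _ Vx.
have [n [z [Uza Uzb Vw]]] := fwd_approach ab cU cV (cosubgrp_open cV) Up.
set w := _ * _ in Vw.
have Uw : fwd b U w by exact: (subgrpM sUb (fwd_iter n Up) (subgrpV sUb Uzb)).
have {}Vw : fwd b V w by apply: (bounded_fwd ba tV') => //;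
  apply: fwd_bounded Uw.
pose z' := iter n a z; pose y := iter n a w.
have Uz'a : fwd a U z' by apply: fwd_iter.
have Uz'b : fwd b U z'.
  have [] // := @eventually_bounded_fwd a b U z' ab tU.
    by exists n; rewrite /z' (iter_autK n ab).
  by apply: fwd_bounded Uz'a.
have py : p = y * z'.
  by rewrite /y /z' -(iter_autM n ab) /w mulgVK (iter_autK n ba).
have Uy : fwd b U y by rewrite -(mulgK z' y) -py; apply: (subgrpM sUb) => //;
  apply: (subgrpV sUb).
have Uzq : fwd a U (z' * q) by apply: (subgrpM sUa).
have xy : x = y * (z' * q) by rewrite xpq py mulgA.
have e : r^-1 * y = s * (z' * q)^-1.
  by rewrite -[y](mulgK (z' * q)) -xy xrs mulgA mulKg.
have Vry : fwd b V (r^-1 * y).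
  have [] // := @eventually_bounded_fwd a b V (r^-1 * y) ab tV.
    apply: (subgrpM (eventually_in_subgrp ba cV)).
      by apply: fwd_eventually; apply: (subgrpV sVb).
    by exists n; rewrite /y (iter_autK n ab).
  rewrite e; apply: (boundedM ab); first exact: fwd_bounded Vs.
  by apply: (boundedV ab); apply: fwd_bounded Uzq.
have Vy : fwd b V y by rewrite -(mulVKg r y); apply: (subgrpM sVb).
exists y, (z' * q); split=> //.
have Vzq : fwd a V (z' * q).
  apply: (bounded_fwd ab tV); last exact: fwd_bounded Uzq.
  rewrite -[z' * q](mulKg y) -xy; apply: (subgrpM cV) => //.
  by apply: (subgrpV cV); apply: fwd_sub Vy.
by move=> k; split; [exact: (Uzq k)|exact: (Vzq k)].
Qed.
Lemma image_preimage_aut a b V : aut_pair a b -> a @` V = b @^-1` V.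
Proof.
move=> ab; apply/seteqP; split=> [_ [x Vx <-]|x Vx] /=; first
  by rewrite (autK ab).
by exists (b x) => //; rewrite (autVK ab).
Qed.

End Dynamics.

(** * Enlarging a tidy subgroup by an invariant compact subgroup *)

(** The elements [x] with x K V contained in K V; for K compact and V open, this
    is the stabilizer of the finite subset KV/V of G/V
    ([coset_stabilizer_cosubgrp]). *)
Definition coset_stabilizer (G : groupType) (K V : set G) : set G :=
  [set x | forall k, K k -> exists2 k', K k' & V (k'^-1 * (x * k))].

Section CosetStabilizer.
Variable G : topologicalGroupType.
Implicit Types (V C K : set G) (x y : G) (a b : G -> G).

Lemma conjugate_core_open K V : subgrp K -> compact K -> subgrp V -> open V ->
  let O := [set x | forall k, K k -> V (k^-1 * (x * k))] in subgrp O /\ open O.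
Proof.
move=> sK cK sV oV O.
have sO : subgrp O.
  split=> [k _|x y Ox Oy k Kk|x Ox k Kk].
  - by rewrite mul1g mulVg; apply: subgrp1.
  - have -> : k^-1 * (x * y * k) = (k^-1 * (x * k)) * (k^-1 * (y * k)).
      by rewrite !gnorm.
    by apply: (subgrpM sV); [exact: Ox|exact: Oy].
  - have -> : k^-1 * (x^-1 * k) = (k^-1 * (x * k))^-1 by rewrite !gnorm.
    by apply: (subgrpV sV); exact: Ox.
split=> //; apply: subgrp_nbhs1_open => //.
apply: ((compact_near_coveringP K).1 cK G (nbhs 1) (fun i k =>
  V (k^-1 * (i * k)))).
move=> k Kk.
exists ([set k' | V (k^-1 * k')], [set i | V (k^-1 * (i * k))]).
  split=> /=; first exact: nbhs_lcoset.
  have : nbhs (1 * k) [set y | V (k^-1 * y)] by rewrite mul1g;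
    apply: nbhs_lcoset.
  exact: (@mulgr_continuous _ k 1).
case=> k' i [/= Vk' Vi].
have -> : k'^-1 * (i * k') = (k^-1 * k')^-1 * (k^-1 * (i * k)) * (k^-1 * k').
  by rewrite !gnorm.
by apply: (subgrpM sV) => //; apply: (subgrpM sV) => //; apply: (subgrpV sV).
Qed.

(** By definition it is only a semigroup; it is compact, being a closed part of
    KV, and it contains the core of [conjugate_core_open]. *)
Lemma coset_stabilizer_cosubgrp K V : subgrp K -> compact K -> cosubgrp V ->
  cosubgrp (coset_stabilizer K V).
Proof.
move=> sK cK cV;
  have [sO oO] := conjugate_core_open sK cK cV (cosubgrp_open cV).
set O := [set _ | _] in sO oO.
apply: (@compact_semigroup_subgrp _ O) => //.
- apply: (@subclosed_compact _ _ [set p.1 * p.2 | p in K `*` V]).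
  + apply: (closed_right_invariant sO oO) => x w Sx Ow k Kk.
    have [k' Kk' Vk'] := Sx _ Kk; exists k' => //.
    have -> : k'^-1 * (x * w * k) = k'^-1 * (x * k) * (k^-1 * (w * k)).
      by rewrite !gnorm.
    by apply: (subgrpM cV) => //; apply: Ow.
  + exact: (compact_mulg cK (cosubgrp_compact cV)).
  move=> x /(_ _ (subgrp1 sK)) [k' Kk']; rewrite mulg1 => Vx.
  by exists (k', k'^-1 * x) => //=; rewrite mulVKg.
- move=> k Kk; exists k => //; rewrite mul1g mulVg; exact: (subgrp1 cV).
- move=> x y Sx Sy k Kk; have [k1 Kk1 Vy] := Sy _ Kk;
  have [k2 Kk2 Vx] := Sx _ Kk1.
  exists k2 => //.
  have -> : k2^-1 * (x * y * k) = k2^-1 * (x * k1) * (k1^-1 * (y * k)).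
    by rewrite !gnorm.
  exact: (subgrpM cV).
- by move=> x Ox k Kk; exists k => //; apply: Ox.
Qed.

Lemma sub_coset_stabilizer K V : subgrp K -> subgrp V ->
  K `<=` coset_stabilizer K V.
Proof.
move=> sK sV x Kx k Kk; exists (x * k); first exact: subgrpM.
by rewrite mulVg; apply: subgrp1.
Qed.

(** Write S for the stabilizer.  Points of S with bounded orbit stay in S,
    because x k = k' u with u in V and bounded, so [bounded_fwd] applies to [u].
    For factorization let v = p q be a point of S and V factored in V.
    Correcting by elements of V_0 ([fwd_approach]) gives v = s z t with z in V_0
    and with s, t in V_+, V_- entering S along their backward and forward orbits.
    For k in K the two expressions of v k then produce an element of K V_0 K
    that is a product of an element of V_++ and one of V_--.  It is bounded in
    both directions, so both factors are in V_0, and this forces t k into K V.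
    So t is in S, and with it s z.
    For convexity, if x k is in K v and in K y with v in V and y in a^-n(V), then
    v and y differ by an element of K, and factoring both shows that the
    corresponding V_+ parts differ by an element of V_0, which puts v in
    a^-j(V) for all j <= n. *)
Lemma coset_stabilizer_factor_convex a b K V : aut_pair a b ->
  subgrp K -> compact K ->
  (forall k, K k -> K (a k)) -> (forall k, K k -> K (b k)) ->
  factor_convex a b V -> factor_convex a b (coset_stabilizer K V).
Proof.
move=> ab sK cK Ka Kb tV; have ba := aut_pair_sym ab.
have tV' := factor_convex_sym ab tV.
have [cV fV xV] := tV; have oV := cosubgrp_open cV;
  have KV := cosubgrp_compact cV.
have sVa := fwd_subgrp ab cV; have sVb := fwd_subgrp ba cV.
have Kan n k : K k -> K (iter n a k) by move=> Kk; elim: n => //= n; apply: Ka.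
have Kbn n k : K k -> K (iter n b k) by move=> Kk; elim: n => //= n; apply: Kb.
set S := coset_stabilizer K V;
  have cS : cosubgrp S := coset_stabilizer_cosubgrp sK cK cV.
have KS : K `<=` S := sub_coset_stabilizer sK cV.
have bKa k : K k -> bounded a k by move=> Kk; exists K => //; exists 0%N => n;
  apply: Kan.
have bKb k : K k -> bounded b k by move=> Kk; exists K => //; exists 0%N => n;
  apply: Kbn.
have fKa k : K k -> fwd a S k by move=> Kk n; apply: KS; apply: Kan.
have fKb k : K k -> fwd b S k by move=> Kk n; apply: KS; apply: Kbn.
(* used with [c], [d] equal to [a], [b] and to [b], [a]: both directions of
   time occur below *)
have Sfwd c d : aut_pair c d -> factor_convex c d V ->
    (forall n k, K k -> K (iter n c k)) ->
    (forall n k, K k -> K (iter n d k)) -> (forall k, K k -> bounded c k) ->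
    forall x, S x -> bounded c x -> fwd c S x.
  move=> cd tc Kc Kd bK x Sx bx n k Kk.
  have [k' Kk' Vk'] := Sx _ (Kd n _ Kk).
  exists (iter n c k'); first exact: Kc.
  have : fwd c V (k'^-1 * (x * iter n d k)).
    apply: (bounded_fwd cd tc) => //.
    apply: (boundedM cd); first by apply: (boundedV cd); apply: bK.
    by apply: (boundedM cd) => //; apply: bK; apply: Kd.
  move=> /(_ n); rewrite !(iter_autM _ cd) (iter_autV _ _ cd).
  by rewrite (iter_autK n (aut_pair_sym cd)).
have Sa := Sfwd _ _ ab tV Kan Kbn bKa.
have Sb := Sfwd _ _ ba tV' Kbn Kan bKb.
have Sev c d : aut_pair c d -> factor_convex c d V ->
    (forall n k, K k -> K (iter n c k)) -> (forall n k, K k ->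
      K (iter n d k)) ->
    (forall k, K k -> bounded c k) ->
    forall t m, fwd c V t -> S (iter m c t) ->
    forall k, K k -> exists2 k2, K k2 & eventually_in c V (k2^-1 * (t * k)).
  move=> cd tc Kc Kd bK t m Vt St k Kk.
  have [k' Kk' Vk'] := St _ (Kc m _ Kk).
  exists (iter m d k'); first exact: Kd.
  exists m; rewrite !(iter_autM _ cd) (iter_autV _ _ cd) (iter_autK m (aut_pair_sym cd)).
  apply: (bounded_fwd cd tc) => //.
  apply: (boundedM cd); first by apply: (boundedV cd); apply: bK.
  apply: (boundedM cd); last by apply: bK; apply: Kc.
  by apply: fwd_bounded KV _; apply: fwd_iter.
split=> // [x Sx|n x Sx Snx j jn].
- have [k0 Kk0] := Sx _ (subgrp1 sK); rewrite mulg1; set v := _ * _ => Vv.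
  have Sv : S v by apply: (subgrpM cS) => //; apply: (subgrpV cS); apply: KS.
  have [p [q [Vp Vq vpq]]] := fV _ Vv.
  have [n [z [Vza Vzb Osz]]] := fwd_approach ab cV cS (cosubgrp_open cS) Vp.
  have Vq1 : fwd a V q^-1 by apply: (subgrpV sVa).
  have [m [z' [Vz'b Vz'a Otz]]] := fwd_approach ba cV cS (cosubgrp_open cS) Vq1.
  pose s := iter n a (iter n b p * z^-1).
  pose t := (iter m b (iter m a q^-1 * z'^-1))^-1.
  pose z1 := iter n a z; pose z2 := (iter m b z')^-1.
  have biV c d w l : aut_pair c d -> factor_convex c d V -> fwd c V w ->
    fwd d V w ->
      fwd c V (iter l c w) /\ fwd d V (iter l c w).
    move=> cd tc Vc Vd; apply: (eventually_bounded_fwd cd tc).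
      by exists l; rewrite (iter_autK l cd).
    by apply: fwd_bounded KV _; apply: fwd_iter.
  have [Vz1a Vz1b] : fwd a V z1 /\ fwd b V z1 := biV _ _ _ n ab tV Vza Vzb.
  have [Vz2b Vz2a] : fwd b V z2 /\ fwd a V z2.
    have [] := biV _ _ _ m ba tV' Vz'b Vz'a.
    by move=> ? ?; split; [apply: (subgrpV sVb)|apply: (subgrpV sVa)].
  have ps : p = s * z1.
    by rewrite /s /z1 -(iter_autM n ab) mulgVK (iter_autK n ba).
  have qt : q = z2 * t.
    rewrite /t /z2 -invgM -(iter_autM m ba) mulgVK (iter_autK m ab).
    by rewrite invgK.
  have Vs : fwd b V s.
    by rewrite -(mulgK z1 s) -ps; apply: (subgrpM sVb) => //;
      apply: (subgrpV sVb).
  have Vt : fwd a V t.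
    by rewrite -(mulKg z2 t) -qt; apply: (subgrpM sVa) => //;
      apply: (subgrpV sVa).
  pose z3 := z1 * z2.
  have Vz3a : fwd a V z3 by apply: (subgrpM sVa).
  have Vz3b : fwd b V z3 by apply: (subgrpM sVb).
  have vst : v = s * z3 * t by rewrite vpq ps qt /z3 !mulgA.
  have Stm : S (iter m a t).
    rewrite /t (iter_autV m _ ab) (iter_autK m ba).
    exact: (subgrpV cS).
  have Ssn : S (iter n b s^-1).
    rewrite /s (iter_autV n _ ba) (iter_autK n ab).
    exact: (subgrpV cS).
  have St : S t.
    move=> k Kk.
    have [k2 Kk2 Vt'] := Sev _ _ ab tV Kan Kbn bKa _ _ Vt Stm _ Kk.
    have [k1 Kk1 Vu] := Sv _ Kk.
    have Vs1 : fwd b V s^-1 by apply: (subgrpV sVb).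
    have [k3 Kk3 Vs'] := Sev _ _ ba tV' Kbn Kan bKb _ _ Vs1 Ssn _ Kk1.
    have [u1 [u2 [Vu1 Vu2 u12]]] := fV _ Vu.
    exists k2 => //.
    set t' := k2^-1 * (t * k) in Vt' *.
    set s' := k3^-1 * (s^-1 * k1) in Vs'.
    pose e := s' * u1; pose f := u2 * t'^-1.
    pose h := k3^-1 * z3 * k2.
    have hef : h = e * f.
      rewrite /e /f mulgA -[s' * u1 * u2]mulgA -u12 vst /h /s' /t'.
      by rewrite !gnorm.
    have bha : bounded a h.
      apply: (boundedM ab); last exact: bKa.
      apply: (boundedM ab); first by apply: (boundedV ab); apply: bKa.
      exact: fwd_bounded Vz3a.
    have bhb : bounded b h.
      apply: (boundedM ba); last exact: bKb.
      apply: (boundedM ba); first by apply: (boundedV ba); apply: bKb.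
      exact: fwd_bounded Vz3b.
    have Ve : eventually_in b V e.
      by apply: (subgrpM (eventually_in_subgrp ba cV)) => //;
        apply: fwd_eventually.
    have Vf : eventually_in a V f.
      apply: (subgrpM (eventually_in_subgrp ab cV));
        first exact: fwd_eventually.
      by apply: (subgrpV (eventually_in_subgrp ab cV)).
    have [Vea Veb] : fwd a V e /\ fwd b V e.
      apply: (eventually_bounded_fwd ab tV) => //.
      rewrite -[e](mulgK f) -hef; apply: (boundedM ab) => //.
      by apply: (boundedV ab); apply: eventually_bounded Vf.
    have [Vfb Vfa] : fwd b V f /\ fwd a V f.
      apply: (eventually_bounded_fwd ba tV') => //.
      rewrite -[f](mulKg e) -hef; apply: (boundedM ba) => //.
      by apply: (boundedV ba); apply: eventually_bounded Ve.
    have -> : t' = f^-1 * u2 by rewrite /f !gnorm.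
    by apply: (subgrpM cV); [apply: (subgrpV cV); apply: fwd_sub Vfa|
      apply: fwd_sub Vu2].
  have Sz : S (s * z3).
    by rewrite -[s * z3](mulgK t) -vst; apply: (subgrpM cS) => //;
      apply: (subgrpV cS).
  exists (k0 * (s * z3)), t; split.
  + apply: (subgrpM (fwd_subgrp ba cS)); first exact: fKb.
    by apply: Sb => //; apply: fwd_bounded KV _; apply: (subgrpM sVb).
  + by apply: Sa => //; apply: fwd_bounded KV _.
  + by rewrite -mulgA -vst /v mulVKg.
- move=> k Kk.
  have [k1 Kk1 Vv] := Sx _ (Kbn j _ Kk).
  have [k2 Kk2] := Snx _ (Kan n _ (Kbn j _ Kk)).
  rewrite -(iter_autM n ab); set y := x * iter j b k in Vv *.
  have -> : k2^-1 * iter n a y = iter n a ((iter n b k2)^-1 * y).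
    by rewrite [iter n a (_^-1 * _)](iter_autM n ab) (iter_autV n _ ab) (iter_autK n ba).
  set h2 := iter n b k2; have Kh2 : K h2 by apply: Kbn.
  set v := k1^-1 * y in Vv; set w := h2^-1 * y => Vw.
  have [p [q [Vp Vq vpq]]] := fc_factor tV' Vv.
  have [r [s [Vr Vs wrs]]] := fc_factor tV' Vw.
  pose r' := iter n b r; pose s' := iter n b s.
  have wrs' : w = r' * s'
    by rewrite /r' /s' -(iter_autM n ba) -wrs (iter_autK n ab).
  have Vs' : fwd b V s' by apply: fwd_iter.
  have br' : bounded a r' by rewrite /r' (bounded_iterV _ _ ab);
    apply: fwd_bounded Vr.
  have e : q * s'^-1 = p^-1 * (k1^-1 * h2) * r'.
    have -> : q = p^-1 * v by rewrite vpq mulKg.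
    have -> : s' = r'^-1 * w by rewrite wrs' mulKg.
    by rewrite /v /w !gnorm.
  have [Vca _] : fwd a V (q * s'^-1) /\ fwd b V (q * s'^-1).
    apply: (eventually_bounded_fwd ab tV).
      by apply: fwd_eventually; apply: (subgrpM sVb) => //;
        apply: (subgrpV sVb).
    rewrite e; apply: (boundedM ab) => //; apply: (boundedM ab).
      by apply: (boundedV ab); apply: fwd_bounded Vp.
    by apply: bKa; apply: subgrpM => //; apply: subgrpV.
  exists (iter j a k1); first exact: Kan.
  have -> : (iter j a k1)^-1 * (iter j a x * k) = iter j a v.
    by rewrite /v /y !(iter_autM j ab) (iter_autV j _ ab) (iter_autK j ba).
  have -> : v = p * (q * s'^-1) * s' by rewrite vpq !gnorm.
  rewrite (iter_autM j ab (p * _)) (iter_autM j ab p); apply: (subgrpM cV).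
    by apply: (subgrpM cV); [exact: (Vp j)|exact: (Vca j)].
  by rewrite /s' (iter_cancelr _ ab).
Qed.
End CosetStabilizer.

(** * Indices of compact open subgroups *)

(** The common source of the index estimates: with [f] and [g] sending elements
    to cosets of two subgroups, the numbers of cosets are compared through a map
    of the elements. *)
Lemma leq_card_image (S T : Type) (C D : choiceType) (f : S -> C) (g : T -> D)
    (phi : S -> T) (A : set S) (B : set T) :
  (forall x, A x -> B (phi x)) ->
  (forall x y, A x -> A y -> g (phi x) = g (phi y) -> f x = f y) ->
  finite_set (g @` B) ->
  (#|` fset_set (f @` A)| <= #|` fset_set (g @` B)|)%N.
Proof.
move=> AB fg finB.
have [[x0 _]|A0] := pselect (A !=set0); last first.
  by have -> : A = set0 by [apply/eqP/negPn/negP => /set0P];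
    rewrite image_set0 fset_set0 cardfs0.
have /choice [psi psiP] : forall d, exists c, forall x, A x ->
  g (phi x) = d -> f x = c.
  move=> d; have [[x [Ax <-]]|no] := pselect (exists x, A x /\ g (phi x) = d).
    by exists (f x) => y Ay; apply: fg.
  by exists (f x0) => x Ax e; case: no; exists x.
have sub : (g \o phi) @` A `<=` g @` B.
  by move=> _ [x Ax <-]; exists (phi x) => //; apply: AB.
have fin : finite_set ((g \o phi) @` A) := sub_finite_set sub finB.
have -> : f @` A = psi @` ((g \o phi) @` A).
  apply/seteqP; split=> [_ [x Ax <-]|_ [_ [x Ax <-] <-]].
    by exists (g (phi x)); [exists x|rewrite -(psiP _ x Ax erefl)].
  by exists x => //; apply: psiP.
rewrite fset_set_image //; apply: leq_trans (leq_imfset_card _ _ _) _.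
by apply: fsubset_leq_card; rewrite -fset_set_sub.
Qed.

Lemma subset_fset_card_eq (T : choiceType) (A B : set T) : A `<=` B ->
  finite_set B -> (#|` fset_set B| <= #|` fset_set A|)%N -> A = B.
Proof.
move=> AB finB le.
have finA := sub_finite_set AB finB.
have := AB; rewrite fset_set_sub // => AB'.
have /fsubset_cardP/(_ AB') e : #|` fset_set A| = #|` fset_set B|.
  by apply/eqP; rewrite eqn_leq le fsubset_leq_card.
apply/seteqP; split=> // x Bx.
by have := e x; rewrite !in_fset_set // [x \in B]mem_set // => /set_mem.
Qed.

Section Index.
Variable G : topologicalGroupType.
Implicit Types (V C H K L : set G) (x y : G) (a b : G -> G).

Lemma lcoset_eqP K x y : subgrp K ->
  [set x * k | k in K] = [set y * k | k in K] <-> K (x^-1 * y).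
Proof.
move=> sK; split=> [e|Kxy].
  have : [set y * k | k in K] (y * 1) by exists 1 => //; apply: subgrp1.
  by rewrite -e => -[k Kk]; rewrite mulg1 => <-; rewrite mulKg.
apply/seteqP; split=> _ [k Kk <-].
  exists ((x^-1 * y)^-1 * k); last by rewrite !gnorm.
  by apply: subgrpM => //; apply: subgrpV.
by exists (x^-1 * y * k); [apply: subgrpM|rewrite !gnorm].
Qed.

(** A sequence of elements in pairwise distinct cosets contradicts
    recurrence. *)
Lemma finite_left_cosets H K : compact H -> subgrp K -> open K ->
  finite_set (left_cosets H K).
Proof.
move=> cH sK oK; apply: contrapT => /infiniteP /pcard_leP/unsquash f.
have /choice [y yP] : forall n, exists y, H y /\ [set y * k | k in K] = f n.
  by move=> n; have [y Hy e] := @funS _ _ _ _ f n I; exists y.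
have [n rec] := compact_recurrent cH (fun n => (yP n).1) sK oK.
have [m nm /(lcoset_eqP _ _ sK)] := rec n.+1.
rewrite (yP n).2 (yP m).2 => /(@inj _ _ _ f) nm'.
by move: nm; rewrite nm' ?inE // ltnn.
Qed.

Lemma cosubgrp_finite_left_cosets H K : cosubgrp H -> cosubgrp K ->
  finite_set (left_cosets H K).
Proof. by move=> [_ cH _] [sK _ oK]; apply: finite_left_cosets. Qed.

Lemma leq_index H K H' K' (phi : G -> G) : subgrp K -> subgrp K' ->
  (forall x, H x -> H' (phi x)) ->
  (forall x y, H x -> H y -> K' ((phi x)^-1 * phi y) -> K (x^-1 * y)) ->
  finite_set (left_cosets H' K') ->
  (subgroup_index H K <= subgroup_index H' K')%N.
Proof.
move=> sK sK' HH' KK'; apply: leq_card_image HH' _ => x y Hx Hy.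
by move=> /lcoset_eqP-/(_ sK') /(KK' _ _ Hx Hy) /lcoset_eqP; apply.
Qed.

Lemma index_capr H K : cosubgrp H -> cosubgrp K ->
  subgroup_index H (H `&` K) = subgroup_index H K.
Proof.
move=> cH cK; have cHK := cosubgrpI cH cK.
apply/eqP; rewrite eqn_leq; apply/andP; split.
  apply: (leq_index (phi := id) cHK cK) => // [x y Hx Hy Kxy|];
    last exact: cosubgrp_finite_left_cosets.
  by split=> //; apply: (subgrpM cH) => //; apply: (subgrpV cH).
by apply: (leq_index (phi := id) cK cHK) => // [x y _ _ []|];
  last exact: cosubgrp_finite_left_cosets.
Qed.

(** The representative is chosen from the coset as a set, so equal cosets get
    equal representatives. *)
Lemma coset_representative K : subgrp K -> exists r : G -> G,
  (forall x, K ((r x)^-1 * x)) /\ (forall x y, K (x^-1 * y) -> r x = r y).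
Proof.
move=> sK; exists (fun x => xget 1 [set x * k | k in K]).
split=> [x|x y /lcoset_eqP-> //].
case: xgetP => [_ -> [k Kk <-]|/(_ x)[]].
  by rewrite invgM mulgVK; apply: subgrpV.
by exists 1; [apply: subgrp1|rewrite mulg1].
Qed.

(** Products of indices count pairs of cosets, so that [leq_card_image] applies
    to them. *)
Lemma index_prodE H K L : finite_set (left_cosets H K) ->
  finite_set (left_cosets K L) ->
  let coset2 p := ([set p.1 * k | k in K], [set p.2 * l | l in L]) in
  finite_set (coset2 @` (H `*` K)) /\
  #|` fset_set (coset2 @` (H `*` K))|
    = (subgroup_index H K * subgroup_index K L)%N.
Proof.
move=> fHK fKL coset2.
have -> : coset2 @` (H `*` K) = left_cosets H K `*` left_cosets K L.
  apply/seteqP; split=> [_ [[x y] [/= Hx Ky] <-]|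
    [_ _] [/= [x Hx <-] [y Ky <-]]].
    by split=> /=; [exists x|exists y].
  by exists (x, y).
split; first exact: finite_setX.
rewrite fset_setX // /subgroup_index.
move: (fset_set _) (fset_set _) => A B.
rewrite -(size_allpairs pair); apply/perm_size/uniq_perm;
  first exact: fset_uniq.
  by apply: allpairs_uniq; rewrite ?fset_uniq // => -[? ?] [? ?] _ _ [-> ->].
move=> [x y]; rewrite in_fsetM /=; apply/andP/allpairsP => [[Ax By]|].
  by exists (x, y).
by case=> -[x' y'] [/= Ax By [-> ->]].
Qed.

(** With r(x) depending only on the coset xK, the coset xL is determined by xK
    and by the coset of r(x)^-1 x in K/L. *)
Lemma index_triangle H K L : cosubgrp H -> cosubgrp K -> cosubgrp L ->
  (subgroup_index H L <= subgroup_index H K * subgroup_index K L)%N.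
Proof.
move=> cH cK cL; have [r [rK rE]] := coset_representative cK.
have [f2 <-] := index_prodE (cosubgrp_finite_left_cosets cH cK)
  (cosubgrp_finite_left_cosets cK cL).
apply: (leq_card_image (phi := fun x => (x, (r x)^-1 * x))) f2 => [x Hx|
  x y Hx Hy /=].
  by split=> //=; apply: rK.
case=> /lcoset_eqP-/(_ cK)/rE rxy /lcoset_eqP-/(_ cL); rewrite rxy.
have -> : ((r y)^-1 * x)^-1 * ((r y)^-1 * y) = x^-1 * y by rewrite !gnorm.
by move=> Lxy; apply/lcoset_eqP => //; apply: cL.
Qed.

(** Reverse to [index_triangle]: when the subgroups are nested, the product of a
    representative of hK with an element of K recovers both cosets. *)
Lemma index_mul H K L : cosubgrp H -> cosubgrp K -> cosubgrp L ->
  K `<=` H -> L `<=` K ->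
  subgroup_index H L = (subgroup_index H K * subgroup_index K L)%N.
Proof.
move=> cH cK cL KH LK; apply/eqP; rewrite eqn_leq index_triangle //=.
have [r [rK rE]] := coset_representative cK.
have [f2 <-] := index_prodE (cosubgrp_finite_left_cosets cH cK)
  (cosubgrp_finite_left_cosets cK cL).
apply: (leq_card_image (phi := fun p => r p.1 * p.2));
  last exact: cosubgrp_finite_left_cosets.
  move=> [x k] [/= Hx Kk]; apply: (subgrpM cH); last exact: KH.
  have -> : r x = x * ((r x)^-1 * x)^-1 by rewrite !gnorm.
  by apply: (subgrpM cH) => //; apply: (subgrpV cH); apply: KH.
move=> [x k] [y l] [/= Hx Kk] [/= Hy Kl] /lcoset_eqP-/(_ cL) Lxy.
have rxy : r x = r y.
  have rr z : r (r z) = r z by apply: rE; apply: rK.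
  rewrite -rr -[in RHS]rr; apply: rE.
  have -> : (r x)^-1 * r y = k * ((r x * k)^-1 * (r y * l)) * l^-1
    by rewrite !gnorm.
  by apply: (subgrpM cK); [apply: (subgrpM cK) => //; exact: LK|
    apply: (subgrpV cK)].
congr pair; apply/lcoset_eqP => //; [exact: cK| |exact: cL|].
  have -> : x^-1 * y = ((r x)^-1 * x)^-1 * ((r y)^-1 * y) by rewrite rxy !gnorm.
  by apply: (subgrpM cK) => //; apply: (subgrpV cK).
by move: Lxy; rewrite rxy; have -> : (r y * k)^-1 * (r y * l) = k^-1 * l
  by rewrite !gnorm.
Qed.

Lemma cosubgrp_preimage a b V : aut_pair a b -> cosubgrp V ->
  cosubgrp (b @^-1` V).
Proof.
move=> ab cV; have ba := aut_pair_sym ab; split.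
- split=> /= [|x y Vx Vy|x Vx]; first by rewrite (aut1 ba); apply: (subgrp1 cV).
    by rewrite (autM ba); apply: (subgrpM cV).
  by rewrite (autV _ ba); apply: (subgrpV cV).
- rewrite -(image_preimage_aut V ab).
  apply: continuous_compact; last exact: cosubgrp_compact.
  by apply: continuous_subspaceT; apply: (aut_continuous ab).
- apply: open_comp; last exact: cosubgrp_open.
  by move=> x _; apply: (autV_continuous ab).
Qed.

Lemma index_preimage a b H K : aut_pair a b -> cosubgrp H -> cosubgrp K ->
  subgroup_index (b @^-1` H) (b @^-1` K) = subgroup_index H K.
Proof.
move=> ab cH cK; have ba := aut_pair_sym ab.
have cH' := cosubgrp_preimage ab cH; have cK' := cosubgrp_preimage ab cK.
apply/eqP; rewrite eqn_leq; apply/andP; split.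
  apply: (leq_index (phi := b) cK' cK) => // [x y _ _ /=|];
    last exact: cosubgrp_finite_left_cosets.
  by rewrite (autM ba) (autV _ ba).
apply: (leq_index (phi := a) cK cK') => // [x Hx /=|x y _ _ /=|];
  last exact: cosubgrp_finite_left_cosets.
  by rewrite (autK ab).
by rewrite (autM ba) (autV _ ba) !(autK ab).
Qed.
End Index.

(** * Factoring after finitely many intersections *)

(** For [b] inverse to [a], the intersection of V, a(V), ..., a^n(V). *)
Definition orbit_cap (T : Type) (b : T -> T) (V : set T) (n : nat) : set T :=
  [set x | forall k, (k <= n)%N -> V (iter k b x)].

Section Factoring.
Variable G : topologicalGroupType.
Implicit Types (V C H K L : set G) (x y : G) (a b : G -> G).

Lemma orbit_cap0 b V : orbit_cap b V 0 = V.
Proof.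
apply/seteqP; split=> [x /(_ 0%N)|x Vx k]; first exact.
by rewrite leqn0 => /eqP->.
Qed.

Lemma orbit_capS b V n : orbit_cap b V n.+1 = b @^-1` orbit_cap b V n `&` V.
Proof.
apply/seteqP; split=> [x Vx|x [Vbx Vx] [//|k]].
  by split=> [k kn|]; [rewrite -iterSr; apply: Vx|apply: (Vx 0%N)].
by rewrite ltnS iterSr; apply: Vbx.
Qed.

Lemma orbit_cap_anti b V m n : (m <= n)%N ->
  orbit_cap b V n `<=` orbit_cap b V m.
Proof. by move=> mn x Vx k km; apply: Vx; apply: leq_trans mn. Qed.

Lemma orbit_cap_sub b V n : orbit_cap b V n `<=` V.
Proof. by move=> x /(_ 0%N); apply. Qed.

Lemma orbit_cap_cosubgrp a b V n : aut_pair a b -> cosubgrp V ->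
  cosubgrp (orbit_cap b V n).
Proof.
move=> ab cV; elim: n => [|n IH]; first by rewrite orbit_cap0.
by rewrite orbit_capS; apply: cosubgrpI => //; apply: cosubgrp_preimage ab IH.
Qed.

Lemma fwd_orbit_cap b V n : fwd b V `<=` fwd b (orbit_cap b V n).
Proof. by move=> x Vx m k _; rewrite -iterD. Qed.

Lemma fwd_closed a b V : aut_pair a b -> closed V -> closed (fwd a V).
Proof.
move=> ab cV x clx n.
have In := aut_pair_iter n ab.
apply: (@preimage_closed _ _ (iter n a) V) => //.
  by move=> y _; apply: (aut_continuous In).
by apply: closure_subset clx => y; apply.
Qed.

Lemma closed_factor a b V x m : aut_pair a b -> cosubgrp V ->
  closed [set y | orbit_cap a V m (y^-1 * x)].
Proof.
move=> ab cV; have ba := aut_pair_sym ab.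
have cVm := orbit_cap_cosubgrp m ba cV.
apply: (closed_right_invariant cVm (cosubgrp_open cVm)) => y v /= Vy Vv.
by rewrite invgM -mulgA; apply: (subgrpM cVm) => //; apply: (subgrpV cVm).
Qed.

(** The one-step factorization is iterated: the part that is good up to time
    [m] is refactored at time [m], and the correction, pulled back by [m] steps,
    has its backward orbit in [V], so the good times so far are kept.  Compactness
    then gives a factorization good for all times. *)
Lemma factor_of_step a b V : aut_pair a b -> cosubgrp V ->
  (forall x, V x -> exists2 y, fwd b V y & V (a (y^-1 * x))) ->
  forall x, V x -> exists y z, [/\ fwd b V y, fwd a V z & x = y * z].
Proof.
move=> ab cV step x Vx; have ba := aut_pair_sym ab.
pose F m := fwd b V `&` [set y | orbit_cap a V m (y^-1 * x)].
have nF m : F m !=set0.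
  elim: m => [|m [y [Vy Vym]]].
    exists 1; split; first exact: (subgrp1 (fwd_subgrp ba cV)).
    by rewrite /= orbit_cap0 invg1 mul1g.
  have [z Vz Vaz] := step _ (Vym m (leqnn m)).
  have Vz' : fwd b V (iter m b z) by apply: fwd_iter.
  exists (y * iter m b z); split; first exact: (subgrpM (fwd_subgrp ba cV)).
  move=> k /=; rewrite invgM -mulgA.
  rewrite leq_eqVlt => /predU1P[->|]; last rewrite ltnS => km.
    rewrite iterS (iter_autM m ab) (iter_autV m _ ab) (iter_autK m ba).
    exact: Vaz.
  rewrite (iter_autM k ab); apply: (subgrpM cV); last exact: Vym.
  by rewrite (iter_autV k _ ab) (iter_cancelr _ ab) //; apply: (subgrpV cV).
have clF m : closed (F m).
  by apply: closedI; [apply: fwd_closed ba (cosubgrp_closed cV)|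
    apply: closed_factor ab cV].
have [||y Fy] := compact_nested_cap (cosubgrp_compact cV) _ clF nF.
- by move=> y [/fwd_sub].
- by move=> m n mn y [Vy Vyn]; split=> //; apply: orbit_cap_anti mn _ _.
exists y, (y^-1 * x); split; [exact: (Fy 0%N).1| |by rewrite mulVKg].
by move=> n; exact: ((Fy n).2 n).
Qed.

(** Stability says that each coset of [V] that meets the image under [a] of the
    n-th intersection also meets the images of all later ones; by compactness it
    contains the image of a point with its entire backward orbit in [V], which
    is the one-step factorization. *)
Lemma factor_of_stable_cosets a b V n : aut_pair a b -> cosubgrp V ->
  (forall m, (n <= m)%N -> left_cosets (b @^-1` orbit_cap b V m) V =
                           left_cosets (b @^-1` orbit_cap b V n) V) ->
  forall x, orbit_cap b V n x -> exists y z,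
    [/\ fwd b (orbit_cap b V n) y, fwd a (orbit_cap b V n) z & x = y * z].
Proof.
move=> ab cV stable; have ba := aut_pair_sym ab.
have cVn := orbit_cap_cosubgrp n ab cV.
apply: (factor_of_step ab cVn) => x Vx.
pose F m := orbit_cap b V m `&` [set y | V (a (y^-1 * x))].
have FS m : F m.+1 `<=` F m by move=> y [Vy ?]; split=> //;
  apply: orbit_cap_anti Vy.
have dF m m' : (m <= m')%N -> F m' `<=` F m.
  by move=> mm y [Vy ?]; split=> //; apply: orbit_cap_anti mm _ _.
have nF m : F m !=set0.
  suff [y Fy] : F (maxn m n) !=set0 by exists y; apply: dF Fy; apply: leq_maxl.
  have : left_cosets (b @^-1` orbit_cap b V n) V [set a x * v | v in V].
    by exists (a x) => //=; rewrite (autK ab).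
  rewrite -(stable _ (leq_maxr m n)) => -[w Vw /(lcoset_eqP _ _ cV) Vwx].
  exists (b w); split=> //=.
  by rewrite (autM ab) (autV _ ab) (autVK ab).
have clF m : closed (F m).
  apply: closedI; first exact: cosubgrp_closed (orbit_cap_cosubgrp m ab cV).
  have cV' := cosubgrp_preimage ba cV.
  apply: (closed_right_invariant cV' (cosubgrp_open cV')) => y v /= Vy Vv.
  rewrite invgM -mulgA (autM ab) (autV _ ab).
  by apply: (subgrpM cV) => //; apply: (subgrpV cV).
have [||y Fy] := compact_nested_cap (cosubgrp_compact cV) _ clF nF => //.
  by move=> y [/orbit_cap_sub].
have Vy : fwd b V y by move=> m; apply: (Fy m).1.
exists y; first exact: fwd_orbit_cap.
have Vxy : orbit_cap b V n (y^-1 * x).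
  by apply: (subgrpM cVn) => //; apply: (subgrpV cVn) => k _; apply: Vy.
move=> [|k] kn; first exact: (Fy 0%N).2.
by rewrite iterSr (autK ab); apply: Vxy; apply: ltnW.
Qed.

Lemma left_cosetsS H H' K : H `<=` H' -> left_cosets H K `<=` left_cosets H' K.
Proof. by move=> HH _ [x Hx <-]; exists x => //; apply: HH. Qed.

Lemma stable_cosets a b V m n : aut_pair a b -> cosubgrp V -> (n <= m)%N ->
  (subgroup_index (b @^-1` orbit_cap b V n) V <=
   subgroup_index (b @^-1` orbit_cap b V m) V)%N ->
  left_cosets (b @^-1` orbit_cap b V m) V = left_cosets (b @^-1` orbit_cap b V n) V.
Proof.
move=> ab cV nm; apply: subset_fset_card_eq.
  by apply: left_cosetsS => x; apply: orbit_cap_anti.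
apply: cosubgrp_finite_left_cosets => //.
exact: (cosubgrp_preimage ab (orbit_cap_cosubgrp n ab cV)).
Qed.

(** The number of cosets decreases with [n]; any [n] where it is minimal
    works. *)
Lemma exists_factor a b V : aut_pair a b -> cosubgrp V -> exists n,
  forall x, orbit_cap b V n x -> exists y z,
    [/\ fwd b (orbit_cap b V n) y, fwd a (orbit_cap b V n) z & x = y * z].
Proof.
move=> ab cV.
pose F n := subgroup_index (b @^-1` orbit_cap b V n) V.
have exF : exists k, `[< exists n, F n = k >] by exists (F 0%N);
  apply/asboolP; exists 0%N.
case: (ex_minnP exF) => _ /asboolP[n <-] minF.
exists n; apply: (factor_of_stable_cosets ab cV) => m nm.
by apply: (stable_cosets ab cV nm); apply: minF; apply/asboolP; exists m.
Qed.

End Factoring.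

(** * Minimal displacement is factorization and convexity *)

(** Otherwise (n+1)^k <= m^k, while (n+1)^k / n^k grows at least like
    1 + k/n. *)
Lemma leq_of_expn_bound (c m n : nat) :
  (forall k, (m ^ k <= c * n ^ k)%N) -> (m <= n)%N.
Proof.
move=> bound; rewrite leqNgt; apply/negP => nm.
have grow k : (n ^ k * (n + k) <= m ^ k * n)%N.
  elim: k => [|k IH]; first by rewrite !expn0 addn0.
  rewrite !expnS; apply: leq_trans (_ : n.+1 * (n ^ k * (n + k)) <= _)%N.
    by have := leq0n (n ^ k); nia.
  by rewrite -mulnA; apply: leq_mul.
have [n0|n_gt0] := posnP n.
  have := bound 1%N; rewrite n0 expn1 muln0; move: nm; rewrite n0; lia.
have := leq_trans (grow (c * n)%N) (leq_mul (bound (c * n)%N) (leqnn n)).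
rewrite mulnAC [(_ * n ^ _)%N]mulnC leq_pmul2l ?expn_gt0 ?n_gt0 //.
lia.
Qed.

Section Displacement.
Variable G : topologicalGroupType.
Implicit Types (U V W H K L : set G) (x y : G) (a b : G -> G).

(** The number of cosets of [V] that meet a^n(V), for [b] inverse to [a]; by
    [index_capr] this is the displacement of [V] under a^n. *)
Definition index_iter b n V : nat := subgroup_index (iter n b @^-1` V) V.

Lemma displacementE a b V : aut_pair a b -> cosubgrp V ->
  displacement a V = subgroup_index (b @^-1` V) V.
Proof.
move=> ab cV; rewrite /displacement (image_preimage_aut V ab).
by apply: index_capr => //; apply: cosubgrp_preimage ab _.
Qed.

(** Apply the triangle inequality along a^n(V), a^n(U), U, V: the outer two
    indices do not depend on [n]. *)
Lemma index_iter_comparable a b U V : aut_pair a b -> cosubgrp U ->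
  cosubgrp V ->
  exists c, forall n, (index_iter b n V <= c * index_iter b n U)%N.
Proof.
move=> ab cU cV; exists (subgroup_index V U * subgroup_index U V)%N => n.
have In := aut_pair_iter n ab.
have cUn := cosubgrp_preimage In cU; have cVn := cosubgrp_preimage In cV.
apply: leq_trans (index_triangle cVn cU cV) _.
rewrite mulnAC leq_mul2r; apply/orP; right.
by apply: leq_trans (index_triangle cVn cUn cU) _; rewrite (index_preimage In).
Qed.

Lemma index_iter_submul a b V m n : aut_pair a b -> cosubgrp V ->
  (index_iter b (m * n) V <= index_iter b m V ^ n)%N.
Proof.
move=> ab cV; elim: n => [|n IH].
  rewrite muln0 expn0 /index_iter /subgroup_index.
  have -> : left_cosets (iter 0 b @^-1` V) V = [set V].
    have V1 : [set 1 * v | v in V] = V.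
      by apply/seteqP; split=> [_ [v Vv <-]|v Vv]; [|exists v]; rewrite ?mul1g.
    apply/seteqP; split=> [_ [x Vx <-]|_ ->].
      rewrite /= -[RHS]V1; apply/(lcoset_eqP _ _ cV); rewrite mulg1.
      exact: (subgrpV cV).
    by exists 1; first exact: (subgrp1 cV).
  by rewrite fset_set1 cardfs1.
rewrite mulnS expnS;
  apply: leq_trans (_ : index_iter b m V * index_iter b (m * n) V <= _)%N;
  last by rewrite leq_mul2l IH orbT.
have Im := aut_pair_iter (m * n) ab; have Imn := aut_pair_iter (m + m * n) ab.
have Im' := aut_pair_iter m ab.
apply: leq_trans (index_triangle (cosubgrp_preimage Imn cV) (cosubgrp_preimage Im cV) cV) _.
rewrite leq_mul2r; apply/orP; right.
rewrite /index_iter -(index_preimage Im (cosubgrp_preimage Im' cV) cV).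
rewrite (_ : iter (m + m * n) b @^-1` V = iter (m * n) b @^-1` (iter m b @^-1` V)) //.
by apply/seteqP; split=> x /=; rewrite iterD.
Qed.

Lemma index_gt0 H K : cosubgrp H -> cosubgrp K -> (0 < subgroup_index H K)%N.
Proof.
move=> cH cK; rewrite /subgroup_index cardfs_gt0; apply/fset0Pn.
exists [set 1 * k | k in K]; rewrite in_fset_set.
  by apply/mem_set; exists 1 => //; apply: (subgrp1 cH).
exact: cosubgrp_finite_left_cosets.
Qed.

Lemma index1_sub H K : cosubgrp H -> cosubgrp K ->
  (subgroup_index H K <= 1)%N ->
  H `<=` K.
Proof.
move=> cH cK le x Hx.
have H1 := subgrp1 cH.
have e : [set [set 1 * k | k in K]] = left_cosets H K.
  apply: subset_fset_card_eq.
  - by move=> _ ->; exists 1.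
  - exact: cosubgrp_finite_left_cosets.
  - by rewrite fset_set1 cardfs1.
have : left_cosets H K [set x * k | k in K] by exists x.
rewrite -e => /esym/(lcoset_eqP _ _ cK).
by rewrite invg1 mul1g.
Qed.

(** Replacing the intersection of a^n(V) and V by that of all the intermediate
    a^k(V) gives an index that is exactly a product of one-step indices; it
    equals [index_iter] precisely when convexity holds up to time [n]. *)
Definition index_cap b n V : nat := subgroup_index (iter n b @^-1` V) (orbit_cap b V n).
(** The one-step indices decrease from the displacement of [V]; they are
    constant exactly when [V] factors. *)
Definition index_step b n V : nat := subgroup_index (b @^-1` orbit_cap b V n) V.

Lemma index_capS a b V n : aut_pair a b -> cosubgrp V ->
  index_cap b n.+1 V = (index_cap b n V * index_step b n V)%N.
Proof.
move=> ab cV; have cVn := orbit_cap_cosubgrp n ab cV.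
have cbVn := cosubgrp_preimage ab cVn.
have cVn1 := orbit_cap_cosubgrp n.+1 ab cV.
have In := aut_pair_iter n.+1 ab.
rewrite /index_cap (index_mul (cosubgrp_preimage In cV) cbVn cVn1); last first.
- by rewrite orbit_capS => x [].
- by move=> x /= /(_ n (leqnn n)); rewrite -iterSr.
rewrite orbit_capS (index_capr cbVn cV); congr (_ * _)%N.
rewrite -(index_preimage ab (cosubgrp_preimage (aut_pair_iter n ab) cV) cVn).
congr subgroup_index.
by apply/seteqP; split=> x /=; rewrite -iterSr.
Qed.

Lemma index_cap_prod a b V n : aut_pair a b -> cosubgrp V ->
  index_cap b n V = (\prod_(i < n) index_step b i V)%N.
Proof.
move=> ab cV; elim: n => [|n IH]; last
  by rewrite (index_capS _ ab cV) big_ord_recr IH.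
rewrite big_ord0 /index_cap orbit_cap0; apply/eqP.
rewrite eqn_leq index_gt0 // andbT.
by have := index_iter_submul 0 0 ab cV; rewrite expn0.
Qed.

Lemma index_step_le a b V n : aut_pair a b -> cosubgrp V ->
  (index_step b n V <= index_step b 0 V)%N.
Proof.
move=> ab cV; have ca m := cosubgrp_preimage ab (orbit_cap_cosubgrp m ab cV).
apply: (leq_index (phi := id) cV cV) => //.
  by move=> x; apply: orbit_cap_anti.
exact: cosubgrp_finite_left_cosets.
Qed.

Lemma index_iter_le_cap a b V n : aut_pair a b -> cosubgrp V ->
  (index_iter b n V <= index_cap b n V)%N.
Proof.
move=> ab cV; have cVn := orbit_cap_cosubgrp n ab cV.
apply: (leq_index (phi := id) cV cVn) => //.
  by move=> x y _ _; apply: orbit_cap_sub.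
by apply: cosubgrp_finite_left_cosets => //;
  apply: (cosubgrp_preimage (aut_pair_iter n ab)).
Qed.

(** Convexity identifies [index_iter] with [index_cap], and factorization makes
    all factors of [index_cap_prod] equal: a coset of [V] meeting a(V) contains
    the image of a point of V_+, and these belong to every intersection. *)
Lemma factor_convex_index_iter a b V n : aut_pair a b -> factor_convex a b V ->
  index_iter b n V = (index_iter b 1 V ^ n)%N.
Proof.
move=> ab tV; have cV := fc_cosubgrp tV.
have In := cosubgrp_preimage (aut_pair_iter n ab) cV.
have -> : index_iter b n V = index_cap b n V.
  rewrite /index_iter -(index_capr In cV); congr subgroup_index.
  apply/seteqP; split=> [x [Vnx Vx] k kn|x Vx].
    exact: (fc_convex (factor_convex_sym ab tV) Vx Vnx).
  by split; [exact: (Vx n)|exact: (Vx 0%N)].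
rewrite (index_cap_prod n ab cV) -[in RHS](card_ord n) -prod_nat_const.
apply: eq_bigr => i _; rewrite /index_iter /index_step /subgroup_index.
congr (#|` fset_set _ |); apply/seteqP; split.
  by apply: left_cosetsS => x; apply: orbit_cap_sub.
move=> _ [x Vx <-]; have [y [z [Vy Vz bxyz]]] := fc_factor tV Vx.
exists (a y) => /=; first by rewrite (autK ab) => k _; apply: Vy.
apply/(lcoset_eqP _ _ cV).
have -> : x = a (y * z) by rewrite -bxyz /= (autVK ab).
by rewrite (autM ab) mulKg; apply: (Vz 1%N).
Qed.

Lemma factor_convex_min a b U V : aut_pair a b -> factor_convex a b V ->
  cosubgrp U -> (displacement a V <= displacement a U)%N.
Proof.
move=> ab tV cU; have cV := fc_cosubgrp tV.
rewrite !(displacementE ab) //.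
have [c cP] := index_iter_comparable ab cU cV.
apply: (@leq_of_expn_bound c) => n; rewrite -(factor_convex_index_iter n ab tV).
apply: leq_trans (cP n) _; rewrite leq_mul2l; apply/orP; right.
by rewrite -{1}[n]mul1n; apply: index_iter_submul ab cU.
Qed.

(** The index at time [n] is squeezed between d^n, by comparison with the growth
    rate of [W], and the product of [n] one-step indices, each at most [d].  So
    all of them are equal to [d], which is factorization, and the two indices at
    time [n] agree, which is convexity. *)
Lemma min_factor_convex a b V W : aut_pair a b -> factor_convex a b W ->
  cosubgrp V -> (displacement a V <= displacement a W)%N -> factor_convex a b V.
Proof.
move=> ab tW cV le; have cW := fc_cosubgrp tW.
have {le} : displacement a V = displacement a W.
  by apply/eqP; rewrite eqn_leq le (factor_convex_min ab tW cV).
rewrite !(displacementE ab) //; set d := subgroup_index _ _ => dW.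
have d_gt0 : (0 < d)%N by apply: index_gt0 => //; apply: (cosubgrp_preimage ab).
have Wn n : index_iter b n W = (d ^ n)%N.
  by rewrite (factor_convex_index_iter n ab tW) dW.
have [c cP] := index_iter_comparable ab cV cW.
have geV n : (d ^ n <= index_iter b n V)%N.
  apply: (@leq_of_expn_bound c) => k; rewrite -expnM -Wn.
  apply: leq_trans (cP _) _; rewrite leq_mul2l; apply/orP; right.
  exact: index_iter_submul ab cV.
have step0 : index_step b 0 V = d by rewrite /index_step orbit_cap0.
have capV n : index_cap b n V = (d ^ n)%N.
  apply/eqP; rewrite eqn_leq (leq_trans (geV n) (index_iter_le_cap n ab cV)) andbT.
  rewrite (index_cap_prod n ab cV) -[X in (_ <= _ ^ X)%N](card_ord n) -prod_nat_const.
  by apply: leq_prod => i _; rewrite -step0; apply: index_step_le ab cV.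
have iterV n : index_iter b n V = (d ^ n)%N.
  by apply/eqP; rewrite eqn_leq geV -capV (index_iter_le_cap n ab cV).
split=> //.
- have stable m : left_cosets (b @^-1` orbit_cap b V m) V =
                    left_cosets (b @^-1` orbit_cap b V 0) V.
    apply: (stable_cosets ab cV (leq0n m)).
    have : (index_cap b m V * index_step b m V = index_cap b m V * index_step b 0 V)%N.
      by rewrite -(index_capS m ab cV) !capV step0 expnS mulnC.
    by move=> /eqP; rewrite eqn_pmul2l ?capV ?expn_gt0 ?d_gt0 // => /eqP e;
      rewrite -[X in (X <= _)%N]e.
  by have := factor_of_stable_cosets ab cV (fun m _ => stable m);
    rewrite orbit_cap0.
move=> n x Vx Vnx k kn.
have In := cosubgrp_preimage (aut_pair_iter n ab) cV.
have cI := cosubgrpI In cV; have cVn := orbit_cap_cosubgrp n ab cV.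
have sub : orbit_cap b V n `<=` iter n b @^-1` V `&` V.
  by move=> y Vy; split; [exact: (Vy n)|exact: (Vy 0%N)].
have subI : iter n b @^-1` V `&` V `<=` iter n b @^-1` V by move=> y [].
have := index_mul In cI cVn subI sub.
rewrite (index_capr In cV) -/(index_iter b n V) -/(index_cap b n V) iterV capV.
rewrite -{1}[(d ^ n)%N]muln1 => /eqP;
  rewrite eqn_pmul2l ?expn_gt0 ?d_gt0 // => /eqP e1.
have {}sub : iter n b @^-1` V `&` V `<=` orbit_cap b V n.
  by apply: index1_sub => //; rewrite -e1.
have /sub/(_ (n - k)%N) : (iter n b @^-1` V `&` V) (iter n a x).
  by split=> //=; rewrite (iter_autK n ab).
by rewrite leq_subr (iter_cancelr _ (aut_pair_sym ab)) ?leq_subr // subKn //;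
  apply.
Qed.
End Displacement.

(** * The nub *)

(** For [b] inverse to [a], the intersection of V_++ and V_--. *)
Definition homoclinic (T : Type) (a b : T -> T) (V : set T) : set T :=
  eventually_in a V `&` eventually_in b V.

Definition nub (G : topologicalGroupType) (a b : G -> G) : set G :=
  [set x | forall V, cosubgrp V -> closure (homoclinic a b V) x].

Section Nub.
Variable G : topologicalGroupType.
Implicit Types (U V W H K L : set G) (x y : G) (a b g h : G -> G).

Lemma homoclinic_subgrp a b V : aut_pair a b -> subgrp V ->
  subgrp (homoclinic a b V).
Proof.
move=> ab sV; apply: subgrpI; first exact: eventually_in_subgrp ab sV.
exact: eventually_in_subgrp (aut_pair_sym ab) sV.
Qed.

Lemma homoclinicS a b V W : V `<=` W -> homoclinic a b V `<=` homoclinic a b W.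
Proof. by move=> VW x [[m Vm] [n Vn]]; split; [exists m|exists n];
  apply: fwdS VW _ _. Qed.

Lemma homoclinic_iter a b V n x : aut_pair a b ->
  homoclinic a b V x -> homoclinic a b V (iter n a x).
Proof.
move=> ab [Vx Vx']; split; first by rewrite (eventually_iter _ _ _ ab).
by rewrite (eventually_iterV _ _ _ (aut_pair_sym ab)).
Qed.

Lemma homoclinic_iterV a b V n x : aut_pair a b ->
  homoclinic a b V x -> homoclinic a b V (iter n b x).
Proof.
by move=> ab [Vx Vx'];
  have [] := @homoclinic_iter b a V n x (aut_pair_sym ab) (conj Vx' Vx).
Qed.

(** The homoclinic points of a(V_+) fall into finitely many cosets of [V], so
    representatives can be chosen that return to [V] for good after a common
    time. *)
Lemma homoclinic_uniform_return a b V : aut_pair a b -> cosubgrp V ->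
  let X := [set r | homoclinic a b V r /\ fwd b V (b r)] in
  exists N, forall r, X r ->
    exists2 r', X r' & V (r^-1 * r') /\ forall m, (N <= m)%N -> V (iter m a r').
Proof.
move=> ab cV X; have ba := aut_pair_sym ab.
have cbV := cosubgrp_preimage ab cV.
pose P N c := (exists2 r, X r & V (c^-1 * r)) ->
  exists2 r', X r' & V (c^-1 * r') /\ forall m, (N <= m)%N -> V (iter m a r').
have [|N _ NP] := (compact_near_coveringP _).1 (cosubgrp_compact cbV) nat \oo P _.
  move=> c _; have [[r Xr Vcr]|no] := pselect (exists2 r, X r & V (c^-1 * r));
    last first.
    exists ([set c' | V (c^-1 * c')], setT).
      by split; [exact: (nbhs_lcoset c cV (cosubgrp_open cV))|exists 0%N].
    case=> c' N [/= Vc _] [r Xr Vr]; case: no; exists r => //.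
    have -> : c^-1 * r = (c^-1 * c') * (c'^-1 * r) by rewrite !gnorm.
    exact: (subgrpM cV).
  have [[[N0 VN0] _] _] := Xr.
  exists ([set c' | V (c^-1 * c')], [set N | (N0 <= N)%N]).
    by split; [exact: (nbhs_lcoset c cV (cosubgrp_open cV))|exists N0].
  case=> c' N [/= Vc NN] _; exists r => //; split.
    have -> : c'^-1 * r = (c^-1 * c')^-1 * (c^-1 * r) by rewrite !gnorm.
    by apply: (subgrpM cV) => //; apply: (subgrpV cV).
  move=> m Nm; have := VN0 (m - N0)%N; rewrite -iterD subnK //.
  exact: leq_trans Nm.
exists N => r Xr; apply: (NP N (leqnn N) r).
  by have [_ /(_ 0%N)] := Xr.
by exists r => //; rewrite mulVg; apply: (subgrp1 cV).
Qed.

(** A homoclinic point that needs [n] backward steps to enter V_+, with n > N, is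
    divided by an iterate of a uniformly returning one so as to need only
    [n - 1]; the iterate is past its return time and so lies in [V].  Hence all
    homoclinic points are in V a^N(V), which is compact and closed. *)
Lemma homoclinic_relatively_compact a b V : aut_pair a b -> cosubgrp V ->
  exists2 C, compact C & closure (homoclinic a b V) `<=` C.
Proof.
move=> ab cV; have ba := aut_pair_sym ab.
have [N ret] := homoclinic_uniform_return ab cV.
have sVb := fwd_subgrp ba cV.
have IN := aut_pair_iter N ab; have cVN := cosubgrp_preimage IN cV.
pose C := [set p.1 * p.2 | p in V `*` (iter N b @^-1` V)].
exists C; first exact: (compact_mulg (cosubgrp_compact cV) (cosubgrp_compact cVN)).
have clC : closed C.
  apply: (closed_right_invariant cVN (cosubgrp_open cVN)) =>
    _ v [[u w] /= [Vu Vw] <-] Vv.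
  by exists (u, w * v); [split=> //; apply: (subgrpM cVN)|rewrite /= mulgA].
suff HC : homoclinic a b V `<=` C by move=> x /(closure_subset HC)/clC.
have CV u x : V u -> C x -> C (u * x).
  move=> Vu [[u' w] /= [Vu' Vw] <-].
  by exists (u * u', w); [split=> //; apply: (subgrpM cV)|rewrite /= mulgA].
suff claim n x : homoclinic a b V x -> fwd b V (iter n b x) -> C x.
  by move=> x Hx; have [_ [n Vn]] := Hx; apply: claim Hx Vn.
elim: n x => [|n IH] x Hx Vx.
  exists (1, x); last by rewrite /= mul1g.
  by split; [exact: (subgrp1 cV)|exact: (Vx N)].
have [Nn|nN] := leqP N n; last first.
  exists (1, x); last by rewrite /= mul1g.
  split; first exact: (subgrp1 cV).
  by have := Vx (N - n.+1)%N; rewrite -iterD subnK.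
have [|r' [Hr' Vr'] [Vrr' Nr']] := ret (iter n b x).
  by split=> //; apply: homoclinic_iterV.
have -> : x = iter n a r' * ((iter n a r')^-1 * x) by rewrite mulVKg.
apply: CV; first exact: Nr'.
have sH := homoclinic_subgrp ab cV.
apply: IH.
  by apply: (subgrpM sH) => //; apply: (subgrpV sH); apply: homoclinic_iter.
rewrite (iter_autM n ba) (iter_autV n _ ba) (iter_autK n ab).
case=> [|k].
  by rewrite /= -[_ * _]invgK invgM invgK; apply: (subgrpV cV).
rewrite iterSr (autM ba) (autV _ ba).
by apply: (subgrpM sVb (subgrpV sVb Vr') Vx k).
Qed.

Lemma closure_subgrp H : subgrp H -> subgrp (closure H).
Proof.
move=> sH; split.
- by apply: subset_closure; apply: subgrp1.
- move=> x y Hx Hy B /(@mulg_continuous G (x, y)) [[B1 B2] [/= n1 n2] B12].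
  have [p [Hp Bp]] := Hx _ n1; have [q [Hq Bq]] := Hy _ n2.
  by exists (p * q); split; [apply: subgrpM|apply: (B12 (p, q))].
- move=> x Hx B /(@invg_continuous G x) n1.
  have [p [Hp Bp]] := Hx _ n1.
  by exists p^-1; split; [apply: subgrpV|].
Qed.

Lemma nub_subgrp a b : aut_pair a b -> subgrp (nub a b).
Proof.
move=> ab; have sc V : cosubgrp V -> subgrp (closure (homoclinic a b V)).
  by move=> cV; apply: closure_subgrp; apply: homoclinic_subgrp ab cV.
split=> [V cV|x y Nx Ny V cV|x Nx V cV].
- exact: (subgrp1 (sc V cV)).
- by apply: (subgrpM (sc V cV)); [apply: Nx|apply: Ny].
- by apply: (subgrpV (sc V cV)); apply: Nx.
Qed.

Lemma nub_compact a b U : aut_pair a b -> cosubgrp U -> compact (nub a b).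
Proof.
move=> ab cU; have [C cC HC] := homoclinic_relatively_compact ab cU.
apply: (@subclosed_compact _ _ C) => // [x clx V cV|x Nx].
  by apply: closed_closure; apply: closure_subset clx => y; apply.
by apply: HC; apply: Nx.
Qed.

Lemma nub_invariant a b g h x : aut_pair a b -> aut_pair g h ->
  a \o g = g \o a -> b \o g = g \o b -> nub a b x -> nub a b (g x).
Proof.
move=> ab gh ag bg Nx V cV B nB.
have ng : nbhs x (g @^-1` B) by apply: (aut_continuous gh).
have cV' := cosubgrp_preimage (aut_pair_sym gh) cV.
have [y [[[m Vm] [n Vn]] By]] := Nx _ cV' _ ng.
have com f k z : f \o g = g \o f -> iter k f (g z) = g (iter k f z).
  move=> fg; elim: k => //= k ->.
  by have := congr1 (fun u => u (iter k f z)) fg.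
exists (g y); split=> //; split; [exists m|exists n] => k.
  by rewrite -iterD com // iterD; apply: Vm.
by rewrite -iterD com // iterD; apply: Vn.
Qed.

(** Compactness: the closures of the homoclinic groups form a directed family
    with intersection inside the open set [V], so one of them is in [V]. *)
Lemma nub_sub_homoclinic a b V : aut_pair a b -> cosubgrp V ->
  nub a b `<=` V -> exists2 W, cosubgrp W & W `<=` V /\ homoclinic a b W `<=` V.
Proof.
move=> ab cV NV.
suff [W cW HW] : exists2 W, cosubgrp W & homoclinic a b W `<=` V.
  exists (W `&` V); first exact: cosubgrpI.
  by split=> [x []//|x Hx]; apply: HW; apply: homoclinicS Hx => y [].
apply: contrapT => no.
have [C cC HC] := homoclinic_relatively_compact ab cV.
pose F W := closure (homoclinic a b W) `&` ~` V.
have [||||x _ xF] := @compact_directed_cap G (set G) (@cosubgrp G) F C V cC cV.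
- by move=> x [/HC].
- move=> W cW; apply: closedI; first exact: closed_closure.
  by apply: open_closedC; apply: cosubgrp_open.
- move=> W cW; apply: contrapT => F0; apply: no; exists W => // x Hx.
  apply: contrapT => nV; apply: F0; exists x; split=> //.
  exact: subset_closure.
- move=> W W' cW cW'; exists (W `&` W'); first exact: cosubgrpI.
  by move=> x [Hx nVx]; split; split=> //; apply: closure_subset Hx;
    apply: homoclinicS => y [].
have /NV : nub a b x by move=> W /xF [].
by have [] := xF V cV.
Qed.

(** Take [W] as in [nub_sub_homoclinic], shrunk so that it factors.  A homoclinic
    point [x] of V is, up to V_0, a point [x1] of W_++ with forward orbit
    eventually in [V].  By recurrence two terms of that orbit differ by an
    element of [W], which factors into a point of W_+ and a homoclinic point of
    [W].  Pulling this relation back far enough writes [x1] as a product of two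
    points of W_+ and a homoclinic point of [W], all of which lie in [V]. *)
Lemma homoclinic_sub a b V : aut_pair a b -> cosubgrp V -> nub a b `<=` V ->
  homoclinic a b V `<=` V.
Proof.
move=> ab cV NV; have ba := aut_pair_sym ab.
have [W0 cW0 [WV0 HW0]] := nub_sub_homoclinic ab cV NV.
have [n fW] := exists_factor ab cW0.
set W := orbit_cap b W0 n in fW.
have cW : cosubgrp W := orbit_cap_cosubgrp n ab cW0.
have WW0 : W `<=` W0 := @orbit_cap_sub _ _ _ _.
have WV : W `<=` V by move=> x /WW0/WV0.
have HWV : homoclinic a b W `<=` V by move=> x Hx; apply: HW0;
  apply: homoclinicS Hx.
have sVa := fwd_subgrp ab cV; have sVb := fwd_subgrp ba cV.
have sWa := eventually_in_subgrp ab cW; have sWb := eventually_in_subgrp ba cW.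
have sH := homoclinic_subgrp ab cW.
move=> x [[ja Vja] [jb Vjb]].
(* far enough in the past, the orbit of [x] is at a point of W_+ times a point
   of V_0 *)
have [i [z [Vza Vzb Wz]]] := fwd_approach ab cV cW (cosubgrp_open cW) Vjb.
have [p [q [Wp Wq pq]]] := fW _ Wz.
have Vq : fwd b V q.
  have -> : q = p^-1 * (iter i b (iter jb b x) * z^-1) by rewrite pq mulKg.
  apply: (subgrpM sVb); first by apply: (subgrpV sVb); apply: fwdS Wp.
  by apply: (subgrpM sVb (fwd_iter i Vjb)); apply: (subgrpV sVb).
pose z' := q * z.
have Vz'a : fwd a V z' by apply: (subgrpM sVa) => //; apply: fwdS Wq.
have Vz'b : fwd b V z' by apply: (subgrpM sVb).
have xpz : iter (i + jb) b x = p * z' by rewrite iterD /z' mulgA -pq mulgVK.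
pose l := (i + jb)%N; pose x1 := iter l a p; pose z1 := iter l a z'.
have xx1 : x = x1 * z1 by rewrite -(iter_autM l ab) -xpz (iter_autK l ba).
suff Vx1 : V x1 by rewrite xx1; apply: (subgrpM cV) => //; apply: Vz'a.
have [M VM] : eventually_in a V x1.
  have sVe := eventually_in_subgrp ab cV.
  rewrite -(mulgK z1 x1) -xx1; apply: (subgrpM sVe); first by exists ja.
  by apply: (subgrpV sVe); apply: fwd_eventually; apply: fwd_iter.
have Vy k : V (iter (M + k) a x1) by rewrite addnC iterD; apply: VM.
have [n0 rec] := compact_recurrent (cosubgrp_compact cV) Vy cW (cosubgrp_open cW).
have [m nm Wu] := rec (n0 + l)%N; set u := _ * _ in Wu.
have [u1 [u2 [Wu1 Wu2 u12]]] := fW _ Wu.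
have ex1 : eventually_in b W x1.
  by rewrite /x1 (eventually_iterV _ _ _ ba); apply: fwd_eventually.
have eu : eventually_in b W u.
  apply: (subgrpM sWb); last by rewrite (eventually_iterV _ _ _ ba).
  by apply: (subgrpV sWb); rewrite (eventually_iterV _ _ _ ba).
have Hu2 : homoclinic a b W u2.
  split; first exact: fwd_eventually.
  have -> : u2 = u1^-1 * u by rewrite u12 mulKg.
  by apply: (subgrpM sWb) => //; apply: (subgrpV sWb); apply: fwd_eventually.
have -> : x1 = iter (M + m) b (iter (M + n0) a x1 * (u1 * u2)).
  by rewrite -u12 /u mulVKg (iter_autK _ ab).
rewrite !(iter_autM _ ba); apply: (subgrpM cV).
  have [Mn Mm] : (M + n0 <= M + m)%N /\ (l <= M + m - (M + n0))%N by lia.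
  rewrite (iter_cancell _ ba) // /x1 (iter_cancell _ ba) //.
  by apply: WV; apply: Wp.
apply: (subgrpM cV); first by apply: WV; apply: Wu1.
by apply: HWV; apply: homoclinic_iterV.
Qed.

(** For x = p q with x and a^n(x) in [V], factor a^n(p) again as r s.  Pulled
    back by [n] steps, [s] differs from [p] by a point of V_+, so it is homoclinic,
    and its whole orbit is in [V]. *)
Lemma factor_convex_of_homoclinic a b V : aut_pair a b -> cosubgrp V ->
  (forall x, V x -> exists y z, [/\ fwd b V y, fwd a V z & x = y * z]) ->
  homoclinic a b V `<=` V -> factor_convex a b V.
Proof.
move=> ab cV fV HV; have ba := aut_pair_sym ab.
have sVa := fwd_subgrp ab cV; have sVb := fwd_subgrp ba cV.
split=> // n x Vx Vnx k kn.
have [p [q [Vp Vq xpq]]] := fV _ Vx.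
have Vnp : V (iter n a p).
  rewrite -(mulgK q p) -xpq (iter_autM n ab) (iter_autV n _ ab).
  by apply: (subgrpM cV) => //; apply: (subgrpV cV).
have [r [s [Vr Vs nrs]]] := fV _ Vnp.
pose s' := iter n b s; pose r' := iter n b r.
have prs : p = r' * s' by rewrite -(iter_autM n ba) -nrs (iter_autK n ab).
have Vr' : fwd b V r' by apply: fwd_iter.
have Hs : homoclinic a b V s'.
  split; first by rewrite (eventually_iterV _ _ _ ab); apply: fwd_eventually.
  rewrite -(mulKg r' s') -prs; apply: fwd_eventually.
  by apply: (subgrpM sVb) => //; apply: (subgrpV sVb).
rewrite xpq prs !(iter_autM k ab); apply: (subgrpM cV); last exact: Vq.
apply: (subgrpM cV); first by rewrite /r' (iter_cancelr _ ab) //; apply: Vr.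
by apply: HV; apply: homoclinic_iter.
Qed.

End Nub.

(** * Commuting automorphisms *)

Section Commuting.
Variable G : topologicalGroupType.
Implicit Types (U V : set G) (a b g h : G -> G).

Lemma factor_convex_preimage a b g h V : aut_pair a b -> aut_pair g h ->
  a \o h = h \o a -> b \o h = h \o b ->
  factor_convex a b V -> factor_convex a b (h @^-1` V).
Proof.
move=> ab gh ah bh [cV fV xV].
have com f k z : f \o h = h \o f -> h (iter k f z) = iter k f (h z).
  move=> fh; elim: k => //= k <-.
  by have := congr1 (fun u => u (iter k f z)) fh.
split; first exact: cosubgrp_preimage gh cV.
  move=> x /fV [y [z [Vy Vz xyz]]]; exists (g y), (g z); split.
  - by move=> n /=; rewrite com // (autK gh).
  - by move=> n /=; rewrite com // (autK gh).
  - by rewrite -(autM gh) -xyz (autVK gh).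
move=> n x /= Vx; rewrite com // => Vnx k kn; rewrite com //.
exact: (xV n).
Qed.

(** The stabilizer comes first: the nub is invariant under [b], so the
    intersection that produces factorization for [b] still contains it. *)
Lemma common_factor_convex (A : set (G -> G)) (inv : (G -> G) -> G -> G)
    b b' U :
  (forall a, A a -> aut_pair a (inv a)) -> aut_pair b b' ->
  (forall a, A a -> b \o a = a \o b) ->
  cosubgrp U -> (forall a, A a -> factor_convex a (inv a) U) ->
  exists W, [/\ cosubgrp W, factor_convex b b' W &
    forall a, A a -> factor_convex a (inv a) W].
Proof.
move=> autA bb comm cU tU; have b'b := aut_pair_sym bb.
have commV f f' g g' : aut_pair f f' -> aut_pair g g' -> f \o g = g \o f ->
    [/\ f' \o g = g \o f', f \o g' = g' \o f & f' \o g' = g' \o f'].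
  move=> ff gg fg.
  have fgx x : f (g x) = g (f x) by have := congr1 (fun u => u x) fg.
  split; apply/funext => x /=.
  - by apply: (can_inj (autK ff)); rewrite fgx !(autVK ff).
  - by apply: (can_inj (autK gg)); rewrite -fgx !(autVK gg).
  - apply: (can_inj (autK ff)); apply: (can_inj (autK gg)).
    by rewrite (autVK ff) (autVK gg) -fgx !(autVK gg, autVK ff).
set K := nub b b'.
have sK : subgrp K := nub_subgrp bb; have cK : compact K := nub_compact bb cU.
pose S := coset_stabilizer K U.
have cS : cosubgrp S := coset_stabilizer_cosubgrp sK cK cU.
have tS a : A a -> factor_convex a (inv a) S.
  move=> Aa; have aa := autA _ Aa.
  have [b'a ba' b'a'] := commV _ _ _ _ bb aa (comm _ Aa).
  apply: (coset_stabilizer_factor_convex aa sK cK) (tU _ Aa) => k.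
    by apply: (nub_invariant bb aa) => //; apply: comm.
  by apply: (nub_invariant bb (aut_pair_sym aa)).
have [n fW] := exists_factor bb cS.
exists (orbit_cap b' S n); have cW := orbit_cap_cosubgrp n bb cS; split=> //.
  apply: (factor_convex_of_homoclinic bb cW fW); apply: (homoclinic_sub bb cW).
  move=> x Kx k _; apply: (sub_coset_stabilizer sK cU).
  elim: k => //= k; apply: (nub_invariant bb b'b) => //.
  by apply/funext => y /=; rewrite (autK bb) (autVK bb).
move=> a Aa; have aa := autA _ Aa.
have [b'a ba' b'a'] := commV _ _ _ _ bb aa (comm _ Aa).
elim: n {fW cW} => [|n IH]; first by rewrite orbit_cap0; apply: tS.
rewrite orbit_capS; apply: (factor_convexI aa) (tS _ Aa).
exact: (factor_convex_preimage aa bb (esym b'a) (esym b'a') IH).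
Qed.
End Commuting.

(** * Tidy subgroups *)

Lemma tidyP (G : topologicalGroupType) (a : G -> G) (V : set G) :
  tidy a V <-> cosubgrp V /\ forall U, cosubgrp U ->
    (displacement a V <= displacement a U)%N.
Proof.
rewrite /tidy /scale; set D := [set displacement a _ | _ in _].
split=> [[/cosubgrpP cV eV]|[cV minV]].
  split=> // U cU.
  have exD : exists k, `[< D k >].
    by exists (displacement a U); apply/asboolP; exists U => //;
      apply/cosubgrpP.
  case: (ex_minnP exD) => m /asboolP Dm minm.
  have [_ lb] : (D `&` lbound D) (displacement a V).
    rewrite eV; case: xgetP => [_ -> //|/(_ m)[]]; split=> // k Dk.
    by apply: minm; apply/asboolP.
  by apply: (lb (displacement a U)); exists U => //; apply/cosubgrpP.
have DV : (D `&` lbound D) (displacement a V).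
  split; first by exists V => //; apply/cosubgrpP.
  by move=> _ [U /cosubgrpP cU <-]; apply: minV.
split; first exact/cosubgrpP.
case: xgetP => [k -> [Dk lbk]|/(_ _ DV)//].
apply/eqP; rewrite eqn_leq; apply/andP; split.
  by have [U /cosubgrpP cU <-] := Dk; apply: minV.
by apply: lbk; case: DV.
Qed.

(** The hypothesis of [min_factor_convex], existence of one [factor_convex]
    subgroup, is [common_factor_convex] for the empty family. *)
Lemma tidy_factor_convex (G : topologicalGroupType) (a b : G -> G) (V : set G) :
  aut_pair a b -> tidy a V <-> factor_convex a b V.
Proof.
move=> ab; rewrite tidyP; split=> [[cV minV]|tV]; last first.
  by split=> [|U cU]; [exact: fc_cosubgrp tV|exact: factor_convex_min ab tV cU].
have [W [cW tW _]] := @common_factor_convex G set0 id a b V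
  (fun _ => False_ind _) ab (fun _ => False_ind _) cV (fun _ => False_ind _).
by apply: (min_factor_convex ab tW cV); apply: minV.
Qed.

Theorem theorem3p4 (G : topologicalGroupType) (hG : tdlc G)
    (A : set (G -> G)) (hA : A `<=` @topAut G)
    (beta : G -> G) (hbeta : topAut beta)
    (hcomm : forall alpha, A alpha -> beta \o alpha = alpha \o beta)
    (hU : exists U : set G,
       compact_open_subgroup U /\ forall alpha, A alpha -> tidy alpha U) :
  exists W : set G,
    compact_open_subgroup W /\
    forall alpha, (A `|` [set beta]) alpha -> tidy alpha W.
Proof.
have [U [/cosubgrpP cU tU]] := hU.
have autP (a : G -> G) : topAut a -> exists b, aut_pair a b.
  by case=> aM [b [aK bK ca cb]]; exists b.
have [beta' bb] := autP _ hbeta.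
have /choice [inv invP] : forall a, exists b, A a -> aut_pair a b.
  move=> a; have [/hA/autP [b ab]|nA] := pselect (A a); first by exists b.
  by exists id => /nA.
have [W [cW tbW tW]] := @common_factor_convex G A inv beta beta' U invP bb hcomm cU
  (fun a Aa => (tidy_factor_convex U (invP a Aa)).1 (tU a Aa)).
exists W; split; first exact/cosubgrpP.
move=> a [Aa|->]; first exact/(tidy_factor_convex W (invP a Aa))/tW.
exact/(tidy_factor_convex W bb).
Qed.
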